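(* (1) $GCTDer(Vir)=CTDer(Vir)=CInn(Vir)$. (2) Let $\mathcal{G}$ be a finite dimensional simple Lie algebra over $\mathbb{C}$. Then $GCTDer(Cur\,\mathcal{G})$ is the set of all $\phi_x\in gc(Cur\,\mathcal{G})$ for which there exist $f(x),g(x)\in\mathbb{C}[x]$ and $d_x\in CInn(Cur\,\mathcal{G})$ such that $$\phi_x(a)=(f(x)\partial+g(x))a+d_x(a)\quad\text{for all } a\in\mathcal{G}.$$
   Context: All vector spaces are over $\mathbb{C}$. A Lie conformal algebra is a $\mathbb{C}[\partial]$-module $\mathcal{R}$ with a $\mathbb{C}$-linear map $\mathcal{R}\otimes\mathcal{R}\to\mathbb{C}[\lambda]\otimes\mathcal{R}$, $a\otimes b\mapsto[a_\lambda b]$, satisfying $[\partial a_\lambda b]=-\lambda[a_\lambda b]$, $[a_\lambda\partial b]=(\partial+\lambda)[a_\lambda b]$, $[a_\lambda b]=-[b_{-\lambda-\partial}a]$, and $[a_\lambda[b_\mu c]]=[[a_\lambda b]_{\lambda+\mu}c]+[b_\mu[a_\lambda c]]$. $Vir=\mathbb{C}[\partial]L$ is the Lie conformal algebra that is free of rank one over $\mathbb{C}[\partial]$ with $[L_\lambda L]=(\partial+2\lambda)L$. For a Lie algebra $\mathcal{G}$, $Cur\,\mathcal{G}=\mathbb{C}[\partial]\otimes\mathcal{G}$ is the Lie conformal algebra with $[a_\lambda b]=[a,b]$ for $a,b\in\mathcal{G}$ (identified with $1\otimes\mathcal{G}$). A conformal linear map on $\mathcal{R}$ is a $\mathbb{C}$-linear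 map $\phi_x:\mathcal{R}\to\mathbb{C}[x]\otimes\mathcal{R}$ with $\phi_x(\partial a)=(\partial+x)\phi_x(a)$; the name of the indeterminate is immaterial. The set of these is denoted $gc(\mathcal{R})$. For $a\in\mathcal{R}$, $ad\,a\in gc(\mathcal{R})$ is given by $(ad\,a)_x(b)=[a_xb]$; $CInn(\mathcal{R})=\{ad\,a: a\in\mathcal{R}\}$. $\phi\in gc(\mathcal{R})$ is a conformal triple derivation if for all $a,b,c\in\mathcal{R}$ $$\phi_x([[a_\lambda b]_{\lambda+\mu}c])=[[\phi_x(a)_{\lambda+x}b]_{\lambda+\mu+x}c]+[[a_\lambda\phi_x(b)]_{\lambda+\mu+x}c]+[[a_\lambda b]_{\lambda+\mu}\phi_x(c)];$$ the set of these is $CTDer(\mathcal{R})$. $\phi\in gc(\mathcal{R})$ is a generalized conformal triple derivation if there exists $\tau\in CTDer(\mathcal{R})$ such that for all $a,b,c\in\mathcal{R}$ $$\phi_x([[a_\lambda b]_{\lambda+\mu}c])=[[\phi_x(a)_{\lambda+x}b]_{\lambda+\mu+x}c]+[[a_\lambda\tau_x(b)]_{\lambda+\mu+x}c]+[[a_\lambda b]_{\lambda+\mu}\tau_x(c)];$$ the set of these is $GCTDer(\mathcal{R})$. *)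

(* Defs.v *)
From HB Require Import structures.
From mathcomp Require Import all_boot all_order all_algebra.
From mathcomp Require Import finmap monalg ring.

Set Implicit Arguments.
Unset Strict Implicit.
Unset Printing Implicit Defensive.

Import GRing.Theory.
Local Open Scope ring_scope.

(* [tens M V] is K[M] (x) V, the finitely supported functions M -> V: if M is the
   monoid of monomials in n variables it is K[X_1, ..., X_n] (x) V.  The alias
   keeps the K-module structure below apart from monalg's own one, which is only
   available when V is a ring. *)
Definition tens (M : choiceType) (V : zmodType) := {malg V[M]}.

HB.instance Definition _ (M : choiceType) (V : zmodType) :=
  GRing.Zmodule.on (tens M V).

(* [mon a m] is the element m (x) a *)
HB.lock Definition mon (M : choiceType) (V : zmodType) (a : V) (m : M) : tens M V :=
  << a *g m >>.

Lemma mon_malgU (M : choiceType) (V : zmodType) (a : V) (m : M) :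
  mon a m = << a *g m >>.
Proof. by rewrite mon.unlock. Qed.

(* the additive map sending m (x) a to f m a *)
HB.lock Definition lift (M : choiceType) (V W : zmodType) (f : M -> V -> W)
  (u : tens M V) : W := \sum_(m <- msupp u) f m u@_m.

Lemma liftE (M : choiceType) (V W : zmodType) (f : M -> V -> W) (u : tens M V) :
  lift f u = \sum_(m <- msupp u) f m u@_m.
Proof. by rewrite lift.unlock. Qed.

Section TensZmod.
Variables (M : choiceType) (V W : zmodType).

Lemma tensE (u : tens M V) : u = \sum_(m <- msupp u) mon u@_m m.
Proof.
by rewrite [LHS]monalgE; apply: eq_bigr => m _; rewrite mon_malgU.
Qed.

Lemma mon_is_additive (m : M) : additive (fun a : V => mon a m).
Proof. by move=> a b; rewrite !mon_malgU raddfB. Qed.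

Lemma liftEw (f : M -> V -> W) (d : {fset M}) (u : tens M V) :
    (forall m, f m 0 = 0) -> (msupp u `<=` d)%fset ->
  lift f u = \sum_(m <- d) f m u@_m.
Proof.
move=> f0 le; rewrite !liftE (big_fset_incl _ le) //.
by move=> m _ /mcoeff_outdom ->.
Qed.

Lemma liftU (f : M -> V -> W) a m : f m 0 = 0 -> lift f (mon a m) = f m a.
Proof.
move=> f0; rewrite !liftE mon_malgU msuppU; case: eqP => [->|_].
  by rewrite big_seq_fset0 f0.
by rewrite big_seq_fset1 mcoeffUU.
Qed.

End TensZmod.

Section TensLmod.
Variables (K : fieldType) (M : choiceType) (V : lmodType K).

Definition tscale (c : K) (u : tens M V) : tens M V :=
  lift (fun m a => mon (c *: a) m) u.

Lemma mcoeff_tscale c u m : (tscale c u)@_m = c *: u@_m.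
Proof.
rewrite /tscale !liftE (raddf_sum (mcoeff m)) /=.
under eq_bigr do rewrite mon_malgU mcoeffU.
have [min|/[dup] mout /mcoeff_outdom ->] := boolP (m \in msupp u).
  rewrite (big_fsetD1 m) //= eqxx big1_fset ?addr0 // => k.
  by rewrite !inE => /andP[/negPf ->].
rewrite scaler0 big1_fset // => k kin _; case: eqP => // E.
by rewrite -E kin in mout.
Qed.

Let tscaleA c d u : tscale c (tscale d u) = tscale (c * d) u.
Proof. by apply/malgP => m; rewrite !mcoeff_tscale scalerA. Qed.
Let tscale1 : left_id 1 tscale.
Proof. by move=> u; apply/malgP => m; rewrite mcoeff_tscale scale1r. Qed.
Let tscaleDr : right_distributive tscale +%R.
Proof.
by move=> c u v; apply/malgP => m; rewrite !(mcoeff_tscale, mcoeffD) scalerDr.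
Qed.
Let tscaleDl u : {morph tscale^~ u : c d / c + d}.
Proof.
by move=> c d; apply/malgP => m; rewrite !(mcoeff_tscale, mcoeffD) scalerDl.
Qed.

HB.instance Definition _ :=
  GRing.Zmodule_isLmodule.Build K (tens M V) tscaleA tscale1 tscaleDr tscaleDl.

Lemma mcoeff_tens (c : K) (u : tens M V) m : (c *: u)@_m = c *: u@_m.
Proof. exact: mcoeff_tscale. Qed.

Lemma mon_is_linear m : linear (fun a : V => mon a m : tens M V).
Proof.
move=> c a b; apply/malgP => k.
by rewrite mcoeffD mcoeff_tens !mon_malgU !mcoeffU mulrnDl scalerMnr.
Qed.

Lemma lift_is_linear (W : lmodType K) (f : M -> V -> W) :
  (forall m, linear (f m)) -> linear (lift f).
Proof.
move=> lf c u v; have f0 m : f m 0 = 0.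
  by have := lf m (-1) 0 0; rewrite scaler0 addr0 scaleN1r addNr.
have sD := fsubsetUl (msupp u `|` msupp v)%fset (msupp (c *: u + v)).
have s0 := fsubsetUr (msupp u `|` msupp v)%fset (msupp (c *: u + v)).
have s1 := fsubset_trans (fsubsetUl (msupp u) (msupp v)) sD.
have s2 := fsubset_trans (fsubsetUr (msupp u) (msupp v)) sD.
rewrite (liftEw f0 s0) (liftEw f0 s1) (liftEw f0 s2) scaler_sumr -big_split /=.
by apply: eq_bigr => m _; rewrite mcoeffD mcoeff_tens lf.
Qed.

(* linear maps on [tens M V] are determined by their values on monomials *)
Lemma tens_ext (W : lmodType K) (f g : tens M V -> W) : linear f -> linear g ->
  (forall a m, f (mon a m) = g (mon a m)) -> f =1 g.
Proof.
move=> lf lg fg u; pose F := GRing.isLinear.Build K _ _ _ f lf.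
pose f' : {linear tens M V -> W} := HB.pack f F.
pose G := GRing.isLinear.Build K _ _ _ g lg.
pose g' : {linear tens M V -> W} := HB.pack g G.
rewrite (tensE u) -[f]/(f' : _ -> _) -[g]/(g' : _ -> _) !linear_sum /=.
by apply: eq_bigr => m _; apply: fg.
Qed.

End TensLmod.

Section LinearMaps.
Variables (K : fieldType) (U V W : lmodType K).

Lemma lin_id : linear (@id V). Proof. by []. Qed.

Lemma lin_comp (f : V -> W) (g : U -> V) :
  linear f -> linear g -> linear (fun u => f (g u)).
Proof. by move=> lf lg c u v; rewrite lg lf. Qed.

Lemma lin_add (f g : V -> W) : linear f -> linear g -> linear (fun v => f v + g v).
Proof. by move=> lf lg c u v; rewrite lf lg scalerDr addrACA. Qed.

Lemma lin_opp (f : V -> W) : linear f -> linear (fun v => - f v).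
Proof. by move=> lf c u v; rewrite lf scalerN opprD. Qed.

Lemma lin_scale (c : K) (f : V -> W) : linear f -> linear (fun v => c *: f v).
Proof. by move=> lf d u v; rewrite lf scalerDr !scalerA mulrC. Qed.

Lemma lin_lift (M : choiceType) (f : U -> M -> V -> W) (v : tens M V) :
  (forall m a, linear (fun u => f u m a)) -> linear (fun u => lift (f u) v).
Proof.
move=> lf c x y; rewrite !liftE scaler_sumr -big_split /=.
by apply: eq_bigr => m _; apply: lf.
Qed.

Lemma lin0 (f : V -> W) : linear f -> f 0 = 0.
Proof. by move=> lf; have := lf (-1) 0 0; rewrite scaler0 addr0 scaleN1r addNr. Qed.

Lemma linD (f : V -> W) : linear f -> {morph f : x y / x + y}.
Proof. by move=> lf x y; have := lf 1 x y; rewrite !scale1r. Qed.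

Lemma linZ (f : V -> W) c : linear f -> {morph f : x / c *: x}.
Proof. by move=> lf x; have := lf c x 0; rewrite !addr0 (lin0 lf) addr0. Qed.

Lemma linN (f : V -> W) : linear f -> {morph f : x / - x}.
Proof. by move=> lf x; rewrite -scaleN1r (linZ _ lf) scaleN1r. Qed.

Lemma linB (f : V -> W) : linear f -> {morph f : x y / x - y}.
Proof. by move=> lf x y; rewrite (linD lf) (linN lf). Qed.

End LinearMaps.

Section Maps.
Variables (K : fieldType) (M : choiceType) (V W : lmodType K).

Definition tmap (f : V -> W) (u : tens M V) : tens M W :=
  lift (fun m a => mon (f a) m) u.

Lemma tmap_is_linear f : linear f -> linear (tmap f).
Proof.
by move=> lf; apply: lift_is_linear => m; exact: (lin_comp (mon_is_linear m) lf).
Qed.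

Lemma tmapU f a m : linear f -> tmap f (mon a m) = mon (f a) m.
Proof. by move=> lf; rewrite /tmap liftU // (lin0 lf) (lin0 (mon_is_linear m)). Qed.

End Maps.

(* V[X] = K[X] (x) V *)
Definition vpoly (V : zmodType) := tens nat V.
HB.instance Definition _ (V : zmodType) := GRing.Zmodule.on (vpoly V).
HB.instance Definition _ (K : fieldType) (V : lmodType K) :=
  GRing.Lmodule.on (vpoly V).

Section VPoly.
Variables (K : fieldType) (V : lmodType K).

(* multiplication by the indeterminate *)
Definition mulX (u : vpoly V) : vpoly V := lift (fun k a => mon a k.+1) u.

(* the element p(X) (x) a *)
Definition ptens (p : {poly K}) (a : V) : vpoly V :=
  \sum_(i < size p) mon (p`_i *: a) (i : nat).

Lemma mulX_is_linear : linear mulX.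
Proof. by apply: lift_is_linear => m; apply: mon_is_linear. Qed.

Lemma mulXU (a : V) k : mulX (mon a k) = mon a k.+1.
Proof. by rewrite /mulX liftU // (lin0 (mon_is_linear _)). Qed.

End VPoly.

Section Scalars.
Variables (K : fieldType) (M : conomType).

(* the K[M]-module structure on K[M] (x) V *)
Definition amul (V : lmodType K) (p : {malg K[M]}) (u : tens M V) : tens M V :=
  lift (fun m (c : K) => lift (fun k a => mon (c *: a) (mmul m k)) u) p.

(* the K[M]-linear extension to K[M] (x) V -> K[M] (x) W of f *)
Definition aext (V W : lmodType K) (f : V -> tens M W) (u : tens M V) : tens M W :=
  lift (fun k a => amul << k >> (f a)) u.

(* the value at s in K[M] of P(X) in V[X] *)
Definition subst (V : lmodType K) (s : {malg K[M]}) (P : vpoly V) : tens M V :=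
  lift (fun j a => amul (s ^+ j) (mon a mone)) P.

(* [u_s v], where br a b = [a_X b] is extended K[M]-bilinearly *)
Definition lbext (V : lmodType K) (br : V -> V -> vpoly V) (s : {malg K[M]})
  (u v : tens M V) : tens M V :=
  aext (fun a => aext (fun b => subst s (br a b)) v) u.

Section One.
Variable V : lmodType K.

Lemma amul_linr (p : {malg K[M]}) : linear (@amul V p).
Proof.
move=> c u v; rewrite /amul !(@liftE M K _) scaler_sumr -big_split /=.
apply: eq_bigr => m _; apply: (@lift_is_linear K M V (tens M V)
  (fun k a => mon (p@_m *: a) (mmul m k)) _ c u v) => k.
exact/(lin_comp (mon_is_linear _))/lin_scale/lin_id.
Qed.

Lemma amulUU c m (a : V) k : amul << c *g m >> (mon a k) = mon (c *: a) (mmul m k).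
Proof.
have E d : lift (fun k0 (a0 : V) => mon (d *: a0) (mmul m k0)) (mon a k) =
  mon (d *: a) (mmul m k).
  by rewrite liftU // scaler0 (lin0 (mon_is_linear _)).
rewrite /amul -(mon_malgU (c : K) m) liftU E //.
by rewrite scale0r (lin0 (mon_is_linear _)).
Qed.

Lemma amulEw (p : {malg K[M]}) (d : {fset M}) (u : tens M V) :
    (msupp p `<=` d)%fset ->
  amul p u =
  \sum_(m <- d) lift (fun k a => mon (p@_m *: a) (mmul m k)) u.
Proof.
move=> le; rewrite /amul (liftEw _ le) // => m.
rewrite !liftE big1 // => k _; by rewrite scale0r (lin0 (mon_is_linear _)).
Qed.

Lemma amulDl (p q : {malg K[M]}) (u : tens M V) :
  amul (p + q) u = amul p u + amul q u.
Proof.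
have sD := fsubsetUl (msupp p `|` msupp q)%fset (msupp (p + q)).
have s0 := fsubsetUr (msupp p `|` msupp q)%fset (msupp (p + q)).
have s1 := fsubset_trans (fsubsetUl (msupp p) (msupp q)) sD.
have s2 := fsubset_trans (fsubsetUr (msupp p) (msupp q)) sD.
rewrite (amulEw _ s0) (amulEw _ s1) (amulEw _ s2) -big_split /=.
apply: eq_bigr => m _; rewrite !liftE -big_split /=; apply: eq_bigr => k _.
by rewrite mcoeffD scalerDl (linD (mon_is_linear _)).
Qed.

Lemma amul0l (u : tens M V) : amul 0 u = 0.
Proof. by have := amulDl 0 0 u; rewrite addr0 => /eqP; rewrite -subr_eq subrr => /eqP. Qed.

Lemma amul_suml I (r : seq I) (p : I -> {malg K[M]}) (u : tens M V) :
  amul (\sum_(i <- r) p i) u = \sum_(i <- r) amul (p i) u.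
Proof.
by elim: r => [|i r IH]; rewrite ?big_nil ?amul0l // !big_cons amulDl IH.
Qed.

Lemma amulNl (p : {malg K[M]}) (u : tens M V) : amul (- p) u = - amul p u.
Proof. by apply/eqP; rewrite -addr_eq0 -amulDl addNr amul0l. Qed.

Lemma amulA (p q : {malg K[M]}) (u : tens M V) :
  amul (p * q) u = amul p (amul q u).
Proof.
apply: (@tens_ext K M V (tens M V) (amul (p * q)) (fun u => amul p (amul q u))).
- exact: amul_linr.
- exact: (lin_comp (amul_linr p) (amul_linr q)).
move=> a k; rewrite (monalgE q) mulr_sumr !amul_suml.
rewrite (big_morph _ (linD (amul_linr p)) (lin0 (amul_linr p))).
apply: eq_bigr => n _; rewrite (monalgE p) mulr_suml !amul_suml.
apply: eq_bigr => m _; rewrite amulUU amulUU malgM_def fgmulUU amulUU.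
by rewrite scalerA mulmA.
Qed.

Lemma amul1 (u : tens M V) : amul 1 u = u.
Proof.
apply: (@tens_ext K M V (tens M V) (amul 1) id) => [||a k] //.
  exact: amul_linr.
by rewrite -[1]/(<< mone >> : {malg K[M]}) amulUU scale1r mul1m.
Qed.

Lemma monE (a : V) k : mon a k = amul << k >> (mon a mone).
Proof. by rewrite amulUU scale1r mulm1. Qed.

Lemma amulC (p q : {malg K[M]}) (u : tens M V) : amul p (amul q u) = amul q (amul p u).
Proof. by rewrite -!amulA mulrC. Qed.

Lemma amulZ (p : {malg K[M]}) c m (u : tens M V) :
  amul (<< c *g m >> * p) u = c *: amul << m >> (amul p u).
Proof.
rewrite amulA; move: (amul p u) => {p}u.
apply: (@tens_ext K M V (tens M V) (amul << c *g m >>)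
  (fun u => c *: amul << m >> u)).
- exact: amul_linr.
- exact/lin_scale/amul_linr.
by move=> a k; rewrite !amulUU scale1r (linZ _ (mon_is_linear _)).
Qed.

Lemma subst_is_linear (s : {malg K[M]}) : linear (@subst V s).
Proof.
by apply: lift_is_linear => j; apply: (lin_comp (amul_linr _)); apply: mon_is_linear.
Qed.

Lemma substU s (a : V) j : subst s (mon a j) = amul (s ^+ j) (mon a mone).
Proof.
by rewrite /subst liftU // (lin0 (mon_is_linear _)) (lin0 (amul_linr _)).
Qed.

Lemma subst1 s (a : V) : subst s (mon a 0%N) = mon a mone.
Proof. by rewrite substU expr0 amul1. Qed.

Lemma subst_mulX s (P : vpoly V) : subst s (mulX P) = amul s (subst s P).
Proof.
apply: (@tens_ext K nat V (tens M V) (fun P => subst s (mulX P))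
  (fun P => amul s (subst s P))).
- exact: (lin_comp (subst_is_linear s) (@mulX_is_linear _ _)).
- exact: (lin_comp (amul_linr s) (subst_is_linear s)).
by move=> a j; rewrite mulXU !substU exprS amulA.
Qed.

End One.

Section Two.
Variables V W : lmodType K.

(* K[M]-linear maps are determined by their values on 1 (x) V *)
Lemma tens_aext (f g : tens M V -> tens M W) : linear f -> linear g ->
  (forall p u, f (amul p u) = amul p (f u)) ->
  (forall p u, g (amul p u) = amul p (g u)) ->
  (forall a, f (mon a mone) = g (mon a mone)) -> f =1 g.
Proof. by move=> lf lg af ag E; apply: tens_ext => // a m; rewrite monE af ag E. Qed.

Section Aext.
Variable f : V -> tens M W.
Hypothesis lf : linear f.

Lemma aext_is_linear : linear (aext f).
Proof. by apply: lift_is_linear => m; apply: (lin_comp (amul_linr _) lf). Qed.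

Lemma aextU a k : aext f (mon a k) = amul << k >> (f a).
Proof. by rewrite /aext liftU // (lin0 lf) (lin0 (amul_linr _)). Qed.

Lemma aext1 a : aext f (mon a mone) = f a.
Proof. by rewrite aextU amul1. Qed.

Lemma aext_amul p u : aext f (amul p u) = amul p (aext f u).
Proof.
apply: (@tens_ext K M V (tens M W) (fun u => aext f (amul p u))
                                   (fun u => amul p (aext f u))).
- exact: (lin_comp aext_is_linear (amul_linr p)).
- exact: (lin_comp (amul_linr p) aext_is_linear).
move=> a k; rewrite aextU (monalgE p) !amul_suml.
rewrite (big_morph _ (linD aext_is_linear) (lin0 aext_is_linear)).
apply: eq_bigr => m _; rewrite amulUU aextU (linZ _ lf) (linZ _ (amul_linr _)).
rewrite -amulA -[<< p@_m *g m >>]mulr1 -mulrA mul1r amulZ -amulA; congr (_ *: amul _ _).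
by rewrite malgM_def fgmulUU mulr1.
Qed.

End Aext.

Lemma tmap_amul (f : V -> W) p (u : tens M V) : linear f ->
  tmap f (amul p u) = amul p (tmap f u).
Proof.
move=> lf; have ltf := @tmap_is_linear K M V W f lf.
apply: (@tens_ext K M V (tens M W) (fun u => tmap f (amul p u))
                                   (fun u => amul p (tmap f u))).
- exact: (lin_comp ltf (amul_linr p)).
- exact: (lin_comp (amul_linr p) ltf).
move=> a k; rewrite tmapU // (monalgE p) !amul_suml.
rewrite (big_morph _ (linD ltf) (lin0 ltf)).
by apply: eq_bigr => m _; rewrite !amulUU tmapU // (linZ _ lf).
Qed.

Lemma subst_tmap s (f : V -> W) (P : vpoly V) : linear f ->
  subst s (tmap f P) = tmap f (subst s P).
Proof.
move=> lf; have ltf := @tmap_is_linear K M V W f lf.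
apply: (@tens_ext K nat V (tens M W) (fun P => subst s (tmap f P))
  (fun P => tmap f (subst s P))).
- exact: (lin_comp (subst_is_linear s) (tmap_is_linear lf)).
- exact: (lin_comp ltf (subst_is_linear s)).
by move=> a j; rewrite tmapU // !substU tmap_amul // tmapU.
Qed.

End Two.
End Scalars.

(* A K[d]-module is a vector space over K with an endomorphism d *)
HB.mixin Record isCdModule (K : fieldType) V of GRing.Lmodule K V := {
  del : V -> V;
  del_is_linear : linear del
}.
#[short(type="cdModType")]
HB.structure Definition CdModule (K : fieldType) :=
  { V of isCdModule K V & GRing.Lmodule K V }.

(* the free module K[d] (x) V, on which d is the multiplication [mulX] *)
Definition cdfree (V : zmodType) := tens nat V.
HB.instance Definition _ (V : zmodType) := GRing.Zmodule.on (cdfree V).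
HB.instance Definition _ (K : fieldType) (V : lmodType K) :=
  GRing.Lmodule.on (cdfree V).
HB.instance Definition _ (K : fieldType) (V : lmodType K) :=
  isCdModule.Build K (cdfree V) (@mulX_is_linear K V).

Section LambdaBracket.
Variables (K : fieldType).

Definition var (n : nat) (i : 'I_n) : {malg K['X_{1..n}]} := << ucm i >>.

(* P(-X-d), where (-X-d)^j acts on the coefficient of X^j in P *)
Definition subst_neg (R : cdModType K) (P : vpoly R) : vpoly R :=
  lift (fun j a => iter j (fun w : vpoly R => - mulX w - tmap del w) (mon a 0%N)) P.

Definition lb_jacobi (R : lmodType K) (br : R -> R -> vpoly R) :=
  let la := @var 2 0 in let mu := @var 2 1 in let lb := lbext br in
  forall a b c : R, let a := mon a mone in let b := mon b mone in
    let c := mon c mone in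
  lb la a (lb mu b c) = lb (la + mu) (lb la a b) c + lb mu b (lb la a c).

End LambdaBracket.

(* [lbr a b] is [a_X b] in R[X] *)
HB.mixin Record isLieConformal (K : fieldType) R of CdModule K R := {
  lbr : R -> R -> vpoly R;
  lbr_linearl : forall b, linear (lbr^~ b);
  lbr_linearr : forall a, linear (lbr a);
  lbr_dell : forall a b, lbr (del a) b = - mulX (lbr a b);
  lbr_delr : forall a b, lbr a (del b) = tmap del (lbr a b) + mulX (lbr a b);
  lbr_skew : forall a b, lbr a b = - subst_neg (lbr b a);
  lbr_jacobi : lb_jacobi lbr
}.
#[short(type="lieConformalType")]
HB.structure Definition LieConformal (K : fieldType) :=
  { R of isLieConformal K R & CdModule K R }.

HB.mixin Record isLieAlgebra (K : fieldType) G of GRing.Lmodule K G := {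
  lieb : G -> G -> G;
  lieb_linearl : forall y, linear (lieb^~ y);
  lieb_linearr : forall x, linear (lieb x);
  lieb_alt : forall x, lieb x x = 0;
  lieb_jacobi : forall x y z,
    lieb x (lieb y z) + lieb y (lieb z x) + lieb z (lieb x y) = 0
}.
#[short(type="lieAlgType")]
HB.structure Definition LieAlgebra (K : fieldType) :=
  { G of isLieAlgebra K G & GRing.Lmodule K G }.
#[short(type="finLieAlgType")]
HB.structure Definition FinLieAlgebra (K : fieldType) :=
  { G of LieAlgebra K G & Vector K G }.

Definition lie_ideal (K : fieldType) (G : finLieAlgType K) (I : {vspace G}) :=
  forall x y, y \in I -> lieb x y \in I.

Definition lie_simple (K : fieldType) (G : finLieAlgType K) :=
  (exists x y : G, lieb x y != 0) /\
  (forall I : {vspace G}, lie_ideal I -> I = 0%VS \/ I = fullv).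

Section GeneralCalculus.
Variables (K : fieldType) (M : conomType) (R : cdModType K).
Variable br : R -> R -> vpoly R.
Hypothesis brl : forall b, linear (br^~ b).
Hypothesis brr : forall a, linear (br a).
Hypothesis brdl : forall a b, br (del a) b = - mulX (br a b).
Hypothesis brdr : forall a b, br a (del b) = tmap del (br a b) + mulX (br a b).
Implicit Types (s p : {malg K[M]}) (u v w : tens M R).

Let inner s a v := aext (fun b => subst s (br a b)) v.

Lemma inner_linr s a : linear (inner s a).
Proof. exact/aext_is_linear/(lin_comp (subst_is_linear s) (brr a)). Qed.

Lemma inner_linl s v : linear (inner s ^~ v).
Proof.
apply: lin_lift => m b; apply: (lin_comp (amul_linr _)).
exact: (lin_comp (subst_is_linear s) (brl b)).
Qed.

Lemma lbext_linl s v : linear ((lbext br s)^~ v).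
Proof. exact/aext_is_linear/inner_linl. Qed.

Lemma lbext_linr s u : linear (lbext br s u).
Proof.
apply: (@lin_lift K _ R _ M (fun v m a => amul << m >> (inner s a v))) => m a.
exact/(lin_comp (amul_linr _))/inner_linr.
Qed.

Lemma lbext_amull s p u v : lbext br s (amul p u) v = amul p (lbext br s u v).
Proof. exact/aext_amul/inner_linl. Qed.

Lemma lbext_amulr s p u v : lbext br s u (amul p v) = amul p (lbext br s u v).
Proof.
apply: (@tens_ext K M R (tens M R) (fun u => lbext br s u (amul p v))
  (fun u => amul p (lbext br s u v))).
- exact: lbext_linl.
- exact: (lin_comp (amul_linr p) (lbext_linl s v)).
move=> a m; have lf := lin_comp (subst_is_linear s) (brr a).
have E w : lbext br s (mon a m) w = amul << m >> (inner s a w).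
  exact: (aextU (inner_linl s w)).
by rewrite (E v) (E (amul p v)) /inner (aext_amul lf) amulC.
Qed.

Lemma lbext1 s a b : lbext br s (mon a mone) (mon b mone) = subst s (br a b).
Proof.
have lf := lin_comp (subst_is_linear s) (brr a).
exact: (etrans (aext1 (inner_linl s _) a) (aext1 lf b)).
Qed.

Let Dlin : linear (tmap del : tens M R -> tens M R).
Proof. exact/tmap_is_linear/del_is_linear. Qed.

Lemma lbext_dell s u v : lbext br s (tmap del u) v = - amul s (lbext br s u v).
Proof.
apply: (@tens_aext K M R R (fun u => lbext br s (tmap del u) v)
  (fun u => - amul s (lbext br s u v))).
- exact: (lin_comp (lbext_linl s v) Dlin).
- exact/lin_opp/(lin_comp (amul_linr s) (lbext_linl s v)).
- by move=> p x; rewrite tmap_amul ?lbext_amull //; apply: del_is_linear.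
- by move=> p x; rewrite lbext_amull amulC (linN (amul_linr p)).
move=> a; rewrite tmapU; last exact: del_is_linear.
apply: (@tens_aext K M R R (fun v => lbext br s (mon (del a) mone) v)
  (fun v => - amul s (lbext br s (mon a mone) v))).
- exact: lbext_linr.
- exact/lin_opp/(lin_comp (amul_linr s) (lbext_linr s _)).
- by move=> p x; rewrite lbext_amulr.
- by move=> p x; rewrite lbext_amulr amulC (linN (amul_linr p)).
by move=> b; rewrite !lbext1 brdl (linN (subst_is_linear s)) subst_mulX.
Qed.

Lemma lbext_delr s u v :
  lbext br s u (tmap del v) = tmap del (lbext br s u v) + amul s (lbext br s u v).
Proof.
have dl := @del_is_linear K R.
apply: (@tens_aext K M R R (fun u => lbext br s u (tmap del v))
  (fun u => tmap del (lbext br s u v) + amul s (lbext br s u v))).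
- exact: lbext_linl.
- apply: lin_add; first exact: (lin_comp Dlin (lbext_linl s v)).
  exact: (lin_comp (amul_linr s) (lbext_linl s v)).
- by move=> p x; rewrite lbext_amull.
- by move=> p x; rewrite lbext_amull tmap_amul // amulC (linD (amul_linr p)).
move=> a.
apply: (@tens_aext K M R R (fun v => lbext br s (mon a mone) (tmap del v))
  (fun v => tmap del (lbext br s (mon a mone) v)
            + amul s (lbext br s (mon a mone) v))).
- exact: (lin_comp (lbext_linr s _) Dlin).
- apply: lin_add; first exact: (lin_comp Dlin (lbext_linr s _)).
  exact: (lin_comp (amul_linr s) (lbext_linr s _)).
- by move=> p x; rewrite tmap_amul // lbext_amulr.
- by move=> p x; rewrite lbext_amulr tmap_amul // amulC (linD (amul_linr p)).
move=> b; rewrite tmapU // !lbext1 brdr (linD (subst_is_linear s)).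
by rewrite subst_tmap // subst_mulX.
Qed.

End GeneralCalculus.

Section SubstNeg.
Variables (K : fieldType) (R : cdModType K).
Implicit Type P : vpoly R.

Let dl := @del_is_linear K R.
Let Dlin : linear (tmap del : vpoly R -> vpoly R).
Proof. exact: tmap_is_linear. Qed.
Let N (w : vpoly R) := - mulX w - tmap del w.
Let Nlin : linear N.
Proof. exact/lin_add/lin_opp/Dlin/lin_opp/mulX_is_linear. Qed.
Let Nilin j : linear (iter j N).
Proof. by elim: j => [|j IH] //; apply: (lin_comp Nlin IH). Qed.

Lemma subst_neg_is_linear : linear (@subst_neg K R).
Proof. by apply: lift_is_linear => j; apply: (lin_comp (Nilin j)); apply: mon_is_linear. Qed.

Lemma subst_negU (a : R) j : subst_neg (mon a j) = iter j N (mon a 0%N).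
Proof.
by rewrite /subst_neg liftU // (lin0 (mon_is_linear _)) (lin0 (Nilin _)).
Qed.

Lemma subst_neg_mulX P : subst_neg (mulX P) = - mulX (subst_neg P) - tmap del (subst_neg P).
Proof.
apply: (@tens_ext K nat R (vpoly R) (fun P => subst_neg (mulX P))
  (fun P => N (subst_neg P))).
- exact: (lin_comp subst_neg_is_linear (@mulX_is_linear _ _)).
- exact: (lin_comp Nlin subst_neg_is_linear).
by move=> a j; rewrite mulXU !subst_negU iterS.
Qed.

Lemma mulX_tmap P : mulX (tmap del P) = tmap del (mulX P).
Proof.
apply: (@tens_ext K nat R (vpoly R) (fun P => mulX (tmap del P))
  (fun P => tmap del (mulX P))).
- exact: (lin_comp (@mulX_is_linear _ _) Dlin).
- exact: (lin_comp Dlin (@mulX_is_linear _ _)).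
by move=> a j; rewrite tmapU // !mulXU tmapU.
Qed.

Lemma subst_neg_tmap P : subst_neg (tmap del P) = tmap del (subst_neg P).
Proof.
apply: (@tens_ext K nat R (vpoly R) (fun P => subst_neg (tmap del P))
  (fun P => tmap del (subst_neg P))).
- exact: (lin_comp subst_neg_is_linear Dlin).
- exact: (lin_comp Dlin subst_neg_is_linear).
move=> a j; rewrite tmapU // !subst_negU; elim: j => [|j IH] /=; first by rewrite tmapU.
by rewrite IH /N mulX_tmap (linB Dlin) (linN Dlin).
Qed.

End SubstNeg.

Section Sesquilinear.
Variables (K : fieldType) (V : lmodType K).
Let R := cdfree V.
Variable B : V -> V -> vpoly R.
Hypothesis Bl : forall b, linear (B^~ b).
Hypothesis Br : forall a, linear (B a).

(* [d^i a _X d^j b] = (-X)^i (d + X)^j [a_X b], where [a_X b] = B a b for a, b in V *)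
Definition sesq (u v : R) : vpoly R :=
  lift (fun i a => iter i (fun w : vpoly R => - mulX w)
    (lift (fun j b => iter j (fun w : vpoly R => tmap del w + mulX w) (B a b)) v)) u.

Let Dlin : linear (tmap del : vpoly R -> vpoly R).
Proof. exact/tmap_is_linear/del_is_linear. Qed.
Let mX (w : vpoly R) := - mulX w.
Let mXlin : linear mX.
Proof. exact/lin_opp/mulX_is_linear. Qed.
Let dX (w : vpoly R) := tmap del w + mulX w.
Let dXlin : linear dX.
Proof. exact/lin_add/mulX_is_linear/Dlin. Qed.
Let iterlin (f : vpoly R -> vpoly R) i : linear f -> linear (iter i f).
Proof. by move=> lf; elim: i => [|i IH] //; apply: (lin_comp lf IH). Qed.
Let inner a (v : R) := lift (fun j b => iter j dX (B a b)) v.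
Let innerr a : linear (inner a).
Proof. by apply: lift_is_linear => j; apply: (lin_comp (iterlin j dXlin) (Br a)). Qed.
Let innerl v : linear (inner^~ v).
Proof. by apply: lin_lift => j b; apply: (lin_comp (iterlin j dXlin) (Bl b)). Qed.

Lemma sesq_linearl v : linear (sesq^~ v).
Proof.
by apply: lift_is_linear => i; apply: (lin_comp (iterlin i mXlin) (innerl v)).
Qed.

Lemma sesq_linearr u : linear (sesq u).
Proof.
apply: (@lin_lift K _ V _ nat (fun v i a => iter i mX (inner a v))) => i a.
exact: (lin_comp (iterlin i mXlin) (innerr a)).
Qed.

Let sesqU a i v : sesq (mon a i) v = iter i mX (inner a v).
Proof.
apply: (@liftU nat V (vpoly R) (fun i a => iter i mX (inner a v))).
by have /= -> := lin0 (innerl v); apply: (lin0 (iterlin i mXlin)).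
Qed.
Let innerU a b j : inner a (mon b j) = iter j dX (B a b).
Proof. by rewrite /inner liftU // (lin0 (Br _)) (lin0 (iterlin _ dXlin)). Qed.

Lemma sesq_dell u v : sesq (del u) v = - mulX (sesq u v).
Proof.
apply: (@tens_ext K nat V (vpoly R) (fun u : R => sesq (del u) v) (fun u : R => mX (sesq u v))).
- exact: (lin_comp (sesq_linearl v) (@del_is_linear K R)).
- exact: (lin_comp mXlin (sesq_linearl v)).
by move=> a i; rewrite sesqU -[del _]/(mulX _) mulXU sesqU.
Qed.

Lemma sesq_delr u v : sesq u (del v) = tmap del (sesq u v) + mulX (sesq u v).
Proof.
apply: (@tens_ext K nat V (vpoly R) (fun u : R => sesq u (del v)) (fun u : R => dX (sesq u v))).
- exact: sesq_linearl.
- exact: (lin_comp dXlin (sesq_linearl v)).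
move=> a i; rewrite !sesqU.
have -> : dX (iter i mX (inner a v)) = iter i mX (dX (inner a v)).
  elim: i => [|i /= <-] //; rewrite /dX /mX (linN Dlin) (linN (@mulX_is_linear _ _)).
  by rewrite (linD (@mulX_is_linear _ _)) mulX_tmap opprD.
congr iter; move: v; apply: (@tens_ext K nat V (vpoly R)
  (fun v : R => inner a (del v)) (fun v : R => dX (inner a v))).
- exact: (lin_comp (innerr a) (@del_is_linear K R)).
- exact: (lin_comp dXlin (innerr a)).
by move=> b j; rewrite innerU -[del _]/(mulX _) mulXU innerU.
Qed.

Lemma sesq_gen a b : sesq (mon a 0%N) (mon b 0%N) = B a b.
Proof. by rewrite sesqU innerU. Qed.

Lemma cdfree_ext (W : lmodType K) (f g : R -> W) : linear f -> linear g ->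
  (forall a : V, f (mon a 0%N) = g (mon a 0%N)) ->
  (forall u, f u = g u -> f (del u) = g (del u)) -> f =1 g.
Proof.
move=> lf lg fg0 fgS; apply: tens_ext => // a; elim=> [|i IH] //.
by have := fgS (mon a i) IH; rewrite -[del _]/(mulX _) mulXU.
Qed.

Lemma sesq_skew : (forall a b, B a b = - subst_neg (B b a)) ->
  forall u v, sesq u v = - subst_neg (sesq v u).
Proof.
move=> BS u v; have nl := @subst_neg_is_linear K R.
have Xl := @mulX_is_linear K R.
move: v; apply: (cdfree_ext (f := sesq u) (g := fun v => - subst_neg (sesq v u))).
- exact: sesq_linearr.
- exact/lin_opp/(lin_comp nl (sesq_linearl u)).
- move=> b; move: u; apply: (cdfree_ext (f := fun u => sesq u (mon b 0%N))
    (g := fun u => - subst_neg (sesq (mon b 0%N) u))).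
  + exact: sesq_linearl.
  + exact/lin_opp/(lin_comp nl (sesq_linearr _)).
  + by move=> a; rewrite !sesq_gen.
  + move=> u E; rewrite sesq_dell sesq_delr E (linD nl) subst_neg_tmap subst_neg_mulX.
    by rewrite addrC subrK opprK (linN Xl) opprK.
- move=> v E; rewrite sesq_dell sesq_delr E (linN nl) subst_neg_mulX.
  by rewrite (linN Xl) (linN Dlin) opprK addrC.
Qed.

Lemma lbext_gen (M : conomType) (s : {malg K[M]}) (a b : V) :
  lbext sesq s (mon (mon a 0%N : R) mone) (mon (mon b 0%N : R) mone) = subst s (B a b).
Proof.
apply: (etrans (lbext1 sesq_linearl sesq_linearr s _ _)).
exact/(congr1 (subst s))/sesq_gen.
Qed.

Lemma sesq_jacobi :
  (forall a b c : V,
    let la := @var K 2 0 in let mu := @var K 2 1 in let lb := lbext sesq in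
    let a' := mon (mon a 0%N : R) mone in let b' := mon (mon b 0%N : R) mone in
    let c' := mon (mon c 0%N : R) mone in
    lb la a' (subst mu (B b c)) =
    lb (la + mu) (subst la (B a b)) c' + lb mu b' (subst la (B a c))) ->
  lb_jacobi sesq.
Proof.
rewrite /lb_jacobi /=; move: (@var K 2 0) (@var K 2 1) => s t J0.
pose lb := lbext (M := 'X_{1..2}) sesq.
have ll p v : linear ((lb p)^~ v) := lbext_linl sesq_linearl p v.
have lr p u : linear (lb p u) := lbext_linr sesq_linearr p u.
have dl p u v : lb p (tmap del u) v = - amul p (lb p u v).
  exact: (lbext_dell sesq_linearl sesq_linearr sesq_dell).
have dr p u v : lb p u (tmap del v) = tmap del (lb p u v) + amul p (lb p u v).
  exact: (lbext_delr sesq_linearl sesq_linearr sesq_delr).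
have al p q u v : lb p (amul q u) v = amul q (lb p u v).
  exact: (lbext_amull sesq_linearl).
have ar p q u v : lb p u (amul q v) = amul q (lb p u v).
  exact: (lbext_amulr sesq_linearl sesq_linearr).
have Dl : linear (tmap del : tens 'X_{1..2} R -> _).
  exact/tmap_is_linear/del_is_linear.
have m0 := @mon_is_linear K 'X_{1..2} R mone.
have tm (u : R) : mon (del u) mone = tmap del (mon u mone) :> tens 'X_{1..2} R.
  by rewrite tmapU //; apply: del_is_linear.
have Eg p (x y : V) :
    lb p (mon (mon x 0%N : R) mone) (mon (mon y 0%N : R) mone) = subst p (B x y).
  exact: lbext_gen.
have aN p (u : tens 'X_{1..2} R) : amul p (- u) = - amul p u.
  exact: (linN (amul_linr p)).
have aD p (u v : tens 'X_{1..2} R) : amul p (u + v) = amul p u + amul p v.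
  exact: (linD (amul_linr p)).
have aDl p q (u : tens 'X_{1..2} R) : amul (p + q) u = amul p u + amul q u.
  exact: amulDl.
have NL p u v : lb p (- u) v = - lb p u v by exact: (linN (ll p v)).
have NR p u v : lb p u (- v) = - lb p u v by exact: (linN (lr p u)).
have DL p u u' v : lb p (u + u') v = lb p u v + lb p u' v by exact: (linD (ll p v)).
have DR p u v v' : lb p u (v + v') = lb p u v + lb p u v' by exact: (linD (lr p u)).
rewrite -/lb in J0 *; clearbody lb => a b c.
move: c; apply: (cdfree_ext
  (f := fun c => lb s (mon a mone) (lb t (mon b mone) (mon c mone)))
  (g := fun c => lb (s + t) (lb s (mon a mone) (mon b mone)) (mon c mone)
               + lb t (mon b mone) (lb s (mon a mone) (mon c mone)))).
- exact: (lin_comp (lr _ _) (lin_comp (lr _ _) m0)).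
- apply: lin_add; first exact: (lin_comp (lr _ _) m0).
  exact: (lin_comp (lr _ _) (lin_comp (lr _ _) m0)).
- move=> c; set C := mon (mon c 0%N : R) mone.
  move: b; apply: (cdfree_ext
    (f := fun b => lb s (mon a mone) (lb t (mon b mone) C))
    (g := fun b => lb (s + t) (lb s (mon a mone) (mon b mone)) C
               + lb t (mon b mone) (lb s (mon a mone) C))).
  + exact: (lin_comp (lr _ _) (lin_comp (ll _ _) m0)).
  + apply: lin_add; first exact: (lin_comp (ll _ _) (lin_comp (lr _ _) m0)).
    exact: (lin_comp (ll _ _) m0).
  + move=> b; set D := mon (mon b 0%N : R) mone.
    move: a; apply: (cdfree_ext
      (f := fun a => lb s (mon a mone) (lb t D C))
      (g := fun a => lb (s + t) (lb s (mon a mone) D) C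
               + lb t D (lb s (mon a mone) C))).
    * exact: (lin_comp (ll _ _) m0).
    * apply: lin_add; first exact: (lin_comp (ll _ _) (lin_comp (ll _ _) m0)).
      exact: (lin_comp (lr _ _) (lin_comp (ll _ _) m0)).
    * by move=> a; rewrite /C /D (Eg t b c) (Eg s a b) (Eg s a c); apply: J0.
    * clearbody C D => a /= E; rewrite (tm a); move: (mon a _) E => {}a E.
      by rewrite !dl NL NR al ar E aD opprD.
  + clearbody C => b /= E; rewrite (tm b).
    move: (mon a _) (mon b _) E => {}a {}b E.
    rewrite !dl !dr NR ar E DL dl al (aDl s t) aD.
    move: (amul s _) (amul t _) (amul t _) => r p q.
    by rewrite !opprD [- r - q]addrC subrK.
- move=> c /= E; rewrite (tm c).
  move: (mon a _) (mon b _) (mon c _) E => {}a {}b {}c E.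
  rewrite !dr !DR !dr !ar E (linD Dl) (aDl s t) !aD.
  move: (tmap del _) (tmap del _) (amul s _) (amul s _) (amul t _) (amul t _).
  move=> x y z w p q.
  by rewrite [y + x + _]addrACA [LHS]addrACA (addrA y w q) (addrAC x p z).
Qed.

End Sesquilinear.

Definition Cur (G : zmodType) := cdfree G.
HB.instance Definition _ (G : zmodType) := GRing.Zmodule.on (Cur G).
HB.instance Definition _ (K : fieldType) (G : lmodType K) := GRing.Lmodule.on (Cur G).
HB.instance Definition _ (K : fieldType) (G : lmodType K) := CdModule.on (Cur G).

Definition cur (G : zmodType) (a : G) : Cur G := mon a 0%N.

Section Current.
Variables (K : fieldType) (G : lieAlgType K).

Definition cur_gen (a b : G) : vpoly (Cur G) := mon (cur (lieb a b)) 0%N.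

Let cur_linear : linear (@cur G).
Proof. exact: mon_is_linear. Qed.
Let cst_linear : linear (fun u : Cur G => mon u 0%N : vpoly (Cur G)).
Proof. exact: mon_is_linear. Qed.

Lemma cur_gen_linearl b : linear (cur_gen^~ b).
Proof. exact: (lin_comp cst_linear (lin_comp cur_linear (lieb_linearl b))). Qed.

Lemma cur_gen_linearr a : linear (cur_gen a).
Proof. exact: (lin_comp cst_linear (lin_comp cur_linear (lieb_linearr a))). Qed.

Lemma lieb_anti (a b : G) : lieb a b = - lieb b a.
Proof.
apply/eqP; rewrite -addr_eq0; have := lieb_alt (a + b).
rewrite (linD (lieb_linearl _)) !(linD (lieb_linearr _)) !lieb_alt add0r addr0.
by move=> ->.
Qed.

Lemma cur_gen_skew a b : cur_gen a b = - subst_neg (cur_gen b a).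
Proof.
by rewrite /cur_gen subst_negU /= lieb_anti (linN cur_linear) (linN cst_linear).
Qed.

Lemma cur_gen_jacobi : lb_jacobi (sesq cur_gen).
Proof.
have gl := cur_gen_linearl; have gr := cur_gen_linearr.
pose gen (x : G) : tens 'X_{1..2} (cdfree G) := mon (mon x 0%N : cdfree G) mone.
have E s x y : subst s (cur_gen x y) = gen (lieb x y) by exact: subst1.
have F s x y : lbext (sesq cur_gen) s (gen x) (gen y) = gen (lieb x y).
  exact: (etrans (lbext_gen gl gr s x y) (E s x y)).
apply: (sesq_jacobi gl gr) => a b c /=; move: (var K 0) (var K 1) => s t.
rewrite (E t b c) (E s a b) (E s a c) (F s a _) (F _ _ c) (F t b _) /gen.
rewrite -(linD (mon_is_linear _)) -(linD (mon_is_linear _)); congr (mon (mon _ _) _).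
have := lieb_jacobi a b c.
rewrite (lieb_anti c a) (lieb_anti c) (linN (lieb_linearr b)) => /eqP.
by rewrite subr_eq0 subr_eq addrC => /eqP.
Qed.

HB.instance Definition _ := isLieConformal.Build K (Cur G)
  (sesq_linearl cur_gen_linearl)
  (sesq_linearr cur_gen_linearr)
  (sesq_dell cur_gen_linearl)
  (sesq_delr cur_gen_linearl cur_gen_linearr)
  (sesq_skew cur_gen_linearl cur_gen_linearr cur_gen_skew)
  cur_gen_jacobi.

Lemma cur_lbr (a b : G) : lbr (cur a) (cur b) = mon (cur (lieb a b)) 0%N.
Proof. exact/(sesq_gen cur_gen_linearl)/cur_gen_linearr. Qed.

End Current.

Definition Vir (K : fieldType) := cdfree K^o.
HB.instance Definition _ (K : fieldType) := GRing.Zmodule.on (Vir K).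
HB.instance Definition _ (K : fieldType) := GRing.Lmodule.on (Vir K).
HB.instance Definition _ (K : fieldType) := CdModule.on (Vir K).

Lemma vir_jacobi_identity (A : comNzRingType) (W : zmodType) (act : A -> W -> W)
    (D : W -> W) (lb : A -> W -> W -> W) (L : W) (s t : A) :
  (forall p q u, act (p + q) u = act p u + act q u) ->
  (forall p u v, act p (u + v) = act p u + act p v) ->
  (forall p q u, act (p * q) u = act p (act q u)) ->
  (forall u, act 1 u = u) ->
  {morph D : u v / u + v} -> (forall p u, D (act p u) = act p (D u)) ->
  (forall p v, {morph (lb p)^~ v : u u' / u + u'}) ->
  (forall p u, {morph lb p u : v v' / v + v'}) ->
  (forall p q u v, lb p (act q u) v = act q (lb p u v)) ->
  (forall p q u v, lb p u (act q v) = act q (lb p u v)) ->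
  (forall p u v, lb p (D u) v = - act p (lb p u v)) ->
  (forall p u v, lb p u (D v) = D (lb p u v) + act p (lb p u v)) ->
  (forall p, lb p L L = D L + act p (L + L)) ->
  lb s L (D L + act t (L + L)) =
  lb (s + t) (D L + act s (L + L)) L + lb t L (D L + act s (L + L)).
Proof.
move=> aDl aD aA a1 DD Da DLl DR al ar lbD lbDr lbL.
have a0 u : act 0 u = 0 by apply: (addIr (act 0 u)); rewrite -aDl !add0r.
have aN p u : act (- p) u = - act p u.
  by apply/eqP; rewrite -addr_eq0 -aDl addNr a0.
pose F p q r := act p (D (D L)) + act q (D L) + act r L.
have FA x p q r : act x (F p q r) = F (x * p) (x * q) (x * r).
  by rewrite /F !aD !aA.
have FD p q r p' q' r' : F p q r + F p' q' r' = F (p + p') (q + q') (r + r').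
  by rewrite /F !aDl addrACA [X in X + _ = _]addrACA.
have FN p q r : - F p q r = F (- p) (- q) (- r) by rewrite /F !opprD !aN.
have FDel q r : D (F 0 q r) = F q r 0 by rewrite /F !a0 add0r addr0 DD !Da.
have lbF p : lb p L L = F 0 1 (p + p) by rewrite lbL /F a0 add0r a1 aD aDl.
rewrite !DR !DLl !lbDr !ar !DR !lbD !al !DLl !lbF !(FDel, FA, FD, FN).
by congr F; ring.
Qed.

Section Virasoro.
Variable K : fieldType.

Definition virL : Vir K := mon (1 : K^o) 0%N.

(* [L_X L] = d L + 2 X L, extended bilinearly to K L *)
Definition vir_gen (a b : K^o) : vpoly (Vir K) :=
  (a * b) *: (mon (del virL) 0%N + mon (2 *: virL) 1%N).

Lemma vir_gen_linearl b : linear (vir_gen^~ b).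
Proof. by move=> c a a'; rewrite /vir_gen mulrDl scalerDl scalerA -mulrA. Qed.

Lemma vir_gen_linearr a : linear (vir_gen a).
Proof.
by move=> c b b'; rewrite /vir_gen mulrDr scalerDl scalerA mulrCA.
Qed.

Let m_linear k : linear (fun u : Vir K => mon u k : vpoly (Vir K)).
Proof. exact: mon_is_linear. Qed.

Lemma vir_gen_skew a b : vir_gen a b = - subst_neg (vir_gen b a).
Proof.
have nl := @subst_neg_is_linear K (Vir K).
rewrite /vir_gen (linZ _ nl) -scalerN mulrC; congr (_ *: _).
rewrite (linD nl) !subst_negU /= mulXU tmapU; last exact: del_is_linear.
rewrite (linZ _ (@del_is_linear K _)) !(linZ _ (m_linear _)).
move: (mon (del virL) _) (mon virL _) => x y.
by rewrite !scaler_nat !mulr2n !opprD !opprK [RHS]addrCA addKr addrC.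
Qed.

Lemma vir_gen_jacobi : lb_jacobi (sesq vir_gen).
Proof.
have gl := vir_gen_linearl; have gr := vir_gen_linearr.
have sl := sesq_linearl gl; have sr := sesq_linearr gr.
have Dl := @del_is_linear K (Vir K).
pose D := tmap del : tens 'X_{1..2} (Vir K) -> tens 'X_{1..2} (Vir K).
have DL : linear D by exact: tmap_is_linear.
pose gen (a : K^o) : tens 'X_{1..2} (Vir K) := mon (mon a 0%N : Vir K) mone.
pose L := gen 1; pose lb := lbext (M := 'X_{1..2}) (sesq vir_gen).
have genE a : gen a = a *: L.
  rewrite /L /gen -(linZ _ (mon_is_linear _)) -(linZ _ (mon_is_linear _)).
  by rewrite -[a *: 1]/(a * 1) mulr1.
have subE s a b : subst s (vir_gen a b) = (a * b) *: (D L + amul s (L + L)).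
  have ls := @subst_is_linear K 'X_{1..2} (Vir K) s.
  rewrite /vir_gen (linZ _ ls) (linD ls) !substU expr0 amul1 expr1; congr (_ *: (_ + _)).
    by rewrite /D /L /gen tmapU.
  by rewrite (linZ _ (mon_is_linear _)) scaler_nat mulr2n.
have lbD s u v : lb s (D u) v = - amul s (lb s u v).
  exact: (lbext_dell sl sr (sesq_dell gl)).
have lbDr s u v : lb s u (D v) = D (lb s u v) + amul s (lb s u v).
  exact: (lbext_delr sl sr (sesq_delr gl gr)).
have ll s v : linear ((lb s)^~ v) := lbext_linl sl s v.
have lr s u : linear (lb s u) := lbext_linr sr s u.
have al s p u v : lb s (amul p u) v = amul p (lb s u v) := lbext_amull sl s p u v.
have ar s p u v : lb s u (amul p v) = amul p (lb s u v) := lbext_amulr sl sr s p u v.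
have lbL s : lb s L L = D L + amul s (L + L).
  by rewrite [LHS](lbext_gen gl gr s 1 1) subE mulr1 scale1r.
apply: (sesq_jacobi gl gr) => a b c /=; move: (var K 0) (var K 1) => s t.
rewrite -/lb -/(gen a) -/(gen b) -/(gen c) !subE !genE.
rewrite !(linZ _ (lr _ _)) !(linZ _ (ll _ _)) !scalerA.
rewrite (mulrC (b * c)) mulrA (mulrC c) (mulrAC a c) -scalerDr; congr (_ *: _).
apply: (vir_jacobi_identity (act := @amul K 'X_{1..2} (Vir K))) => //.
- exact: amulDl.
- by move=> p; apply/linD/amul_linr.
- exact: amulA.
- exact: amul1.
- exact: linD.
- by move=> p u; apply/tmap_amul/del_is_linear.
- by move=> p v; apply/linD/ll.
- by move=> p u; apply/linD/lr.
Qed.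

HB.instance Definition _ := isLieConformal.Build K (Vir K)
  (sesq_linearl vir_gen_linearl) (sesq_linearr vir_gen_linearr)
  (sesq_dell vir_gen_linearl) (sesq_delr vir_gen_linearl vir_gen_linearr)
  (sesq_skew vir_gen_linearl vir_gen_linearr vir_gen_skew) vir_gen_jacobi.

Lemma virL_lbr : lbr virL virL = mon (del virL) 0%N + mon (2 *: virL) 1%N.
Proof.
apply: (etrans (sesq_gen vir_gen_linearl vir_gen_linearr 1 1)).
by rewrite /vir_gen mulr1 scale1r.
Qed.

End Virasoro.

(* A conformal linear map phi is recorded as a |-> phi_X(a) in R[X]; identities
   between its values and brackets are stated in K[la, mu, x] (x) R, to which both
   are extended linearly over K[la, mu, x]. *)
Section ConformalMaps.
Variables (K : fieldType) (R : lieConformalType K).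

Record gc := GC {
  gc_fun :> R -> vpoly R;
  gc_linear : linear gc_fun;
  gc_del : forall a, gc_fun (del a) = tmap del (gc_fun a) + mulX (gc_fun a)
}.

Definition ad (a : R) : gc := GC (lbr_linearr a) (lbr_delr a).

Definition CInn (phi : gc) : Prop := exists a : R, phi =1 ad a.

Definition A3 := {malg K['X_{1..3}]}.
Definition R3 := tens 'X_{1..3} R.

(* [u_s v] and phi_s(u) *)
Definition lb (s : A3) (u v : R3) : R3 := lbext lbr s u v.
Definition app (phi : gc) (s : A3) (u : R3) : R3 :=
  aext (fun a => subst s (phi a)) u.

Definition triple_rule (phi tau : gc) : Prop :=
  let la : A3 := var K 0 in let mu : A3 := var K 1 in let x : A3 := var K 2 in
  forall a b c : R, let a : R3 := mon a mone in let b : R3 := mon b mone in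
    let c : R3 := mon c mone in
  app phi x (lb (la + mu) (lb la a b) c) =
    lb (la + mu + x) (lb (la + x) (app phi x a) b) c
    + lb (la + mu + x) (lb la a (app tau x b)) c
    + lb (la + mu) (lb la a b) (app tau x c).

Definition CTDer (phi : gc) : Prop := triple_rule phi phi.

Definition GCTDer (phi : gc) : Prop :=
  exists tau : gc, CTDer tau /\ triple_rule phi tau.

End ConformalMaps.

(* Main.v *)
(* Since C is infinite, an identity in C[la, mu, x, d] (x) V can be checked at scalars. A
   conformal linear map on C[d] (x) V becomes a family T(d, x) of endomorphisms of V
   that is polynomial in d and x, and the triple rule becomes an identity between
   values of T.

   For Vir, T(d, x) is a scalar t. The difference of phi and tau vanishes because la and
   mu can be chosen so that the remaining term is killed. For tau, another choice gives
   t(4y - 2x, x) = 4 t(y - 2x, x), so that t(d, x) = q(x) (d + 2x), which is inner.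

   For Cur G with G simple and x fixed, the rule for tau forces T(d) to be affine in d,
   with linear coefficient in the centroid, hence a scalar s (Schur), and
   T(0) - s x is a triple derivation of G, hence inner; phi - tau is constant in d and
   lies in the centroid. The scalars and the inner part depend polynomially on x, as
   they are recovered from T by linear maps.

   That triple derivations of a simple G are inner follows from the nondegeneracy of
   the Killing form, which is Cartan's criterion combined with Engel's theorem. *)
From HB Require Import structures.
Require Import Defs.
From mathcomp Require Import all_boot all_order all_algebra.
From mathcomp Require Import finmap monalg reals complex ring.

Set Implicit Arguments.
Unset Strict Implicit.
Unset Printing Implicit Defensive.

Import Order.TTheory GRing.Theory Num.Theory VectorInternalTheory.
Local Open Scope ring_scope.

(** * Linear algebra *)

Definition linear_pack (K : fieldType) (U V : lmodType K) (f : U -> V)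
    (lf : linear f) : {linear U -> V} :=
  HB.pack f (GRing.isLinear.Build K U V _ f lf).

Lemma coprimep_prod_XsubC_exp (F : fieldType) (k : nat) (a : F) (s : seq F) :
  a \notin s ->
  coprimep (('X - a%:P) ^+ k) (\prod_(b <- s) ('X - b%:P) ^+ k).
Proof.
move=> as'; apply: coprimep_expl; rewrite big_seq.
elim/big_ind: _ => [|p q cp cq|b bs]; first exact: coprimep1.
  by rewrite coprimepMr cp.
apply: coprimep_expr; rewrite coprimep_XsubC root_XsubC.
by apply: contraNneq as' => <-.
Qed.

(** With [m] the product of the powers for the tail, [v * m] is 1 modulo [('X - a%:P) ^+ k] and 0
    modulo the other powers, so adding a multiple of it corrects the residue at [a] alone. *)
Lemma poly_crt (F : fieldType) (c : F -> F) (k : nat) (s : seq F) : uniq s ->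
  exists q : {poly F}, forall a, a \in s -> ('X - a%:P) ^+ k %| q - (c a)%:P.
Proof.
elim: s => [|a s IH] /= => [_|/andP[as' us]]; first by exists 0.
have [q qP] := IH us; pose m := \prod_(b <- s) ('X - b%:P) ^+ k.
have := coprimep_prod_XsubC_exp k as'; rewrite -/m => /Bezout_eq1_coprimepP[[u v] /= E].
exists (q + ((c a)%:P - q) * (v * m)) => b; rewrite inE => /orP[/eqP ->|bs].
  have -> : q + ((c a)%:P - q) * (v * m) - (c a)%:P =
            (q - (c a)%:P) * (u * ('X - a%:P) ^+ k).
    have -> : v * m = 1 - u * ('X - a%:P) ^+ k by rewrite -E addrAC subrr add0r.
    by ring.
  by rewrite mulrA dvdp_mulIr.
rewrite addrAC dvdp_addr ?qP // mulrA dvdp_mull //.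
by rewrite /m (big_rem b) //= dvdp_mulIl.
Qed.

(** The factors are pairwise coprime, so the kernel of the product at [A], here the whole space, is
    the sum of their kernels: generalized eigenvectors span. *)
Lemma geigenvectors_ext (F : fieldType) n m (A : 'M[F]_n.+1) (k : nat) (s : seq F)
    (B : 'M[F]_(n.+1, m)) : uniq s ->
  horner_mx A (\prod_(a <- s) ('X - a%:P) ^+ k) = 0 ->
  (forall a (u : 'rV_n.+1), a \in s ->
     u *m horner_mx A (('X - a%:P) ^+ k) = 0 -> u *m B = 0) ->
  B = 0.
Proof.
move=> us A0 sB.
have: (kermxpoly A (\prod_(a <- s) ('X - a%:P) ^+ k) <= kermx B)%MS.
  elim: s us sB {A0} => [_ _|a s IH /= /andP[as' us] sB].
    by rewrite big_nil kermxpoly1 sub0mx.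
  rewrite big_cons (kermxpolyM _ (coprimep_prod_XsubC_exp k as')).
  rewrite addsmx_sub IH ?andbT //; last first.
    by move=> b u bs; apply: sB; rewrite inE bs orbT.
  apply/row_subP => i; apply/sub_kermxP; apply: (sB a); rewrite ?mem_head //.
  exact/sub_kermxP/row_sub.
by rewrite /kermxpoly A0 kermx0 => /sub_kermxP; rewrite mul1mx.
Qed.

Lemma mxtrace_roots (F : fieldType) n (A : 'M[F]_n.+1) (r : seq F) :
  char_poly A = \prod_(z <- r) ('X - z%:P) -> \tr A = \sum_(z <- r) z.
Proof.
move=> E; have sr : size r = n.+1.
  by apply: succn_inj; rewrite -(size_prod_XsubC r id) -E size_char_poly.
have := coefPn_prod_XsubC (ps := r); rewrite sr -E => /(_ isT).
by rewrite char_poly_trace // => /oppr_inj.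
Qed.

Lemma char_poly_split (F : closedFieldType) n (A : 'M[F]_n) :
  {r : seq F | char_poly A = \prod_(z <- r) ('X - z%:P)}.
Proof.
have [r E] := closed_field_poly_normal (char_poly A); exists r.
by rewrite E (monicP (char_poly_monic A)) scale1r.
Qed.

(* If g = p - b were coprime to the characteristic polynomial, then g(A) would be
   invertible. *)
Lemma eigenvalue_horner (F : closedFieldType) n (A : 'M[F]_n.+1) (p : {poly F}) b :
  eigenvalue (horner_mx A p) b -> exists2 a, eigenvalue A a & p.[a] = b.
Proof.
move=> /eigenvalueP[v vE v0]; pose g := p - b%:P.
have vg : v *m horner_mx A g = 0.
  by rewrite rmorphB /= horner_mx_C mulmxBr vE mul_mx_scalar subrr.
have [/Bezout_eq1_coprimepP[[u w] /= E]|] := boolP (coprimep g (char_poly A)).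
  case/eqP: v0; rewrite -[v]mulmx1 -(horner_mx_C A 1) polyC1 -E.
  rewrite rmorphD !rmorphM /= Cayley_Hamilton mulr0 addr0 -mulmxE.
  have -> : horner_mx A u *m horner_mx A g = horner_mx A g *m horner_mx A u.
    by rewrite !mulmxE -!rmorphM mulrC.
  by rewrite mulmxA vg mul0mx.
rewrite coprimep_def => /closed_rootP[a]; rewrite root_gcd => /andP[ga Aa].
exists a; first by rewrite eigenvalue_root_char.
by move: ga; rewrite /g rootE hornerD hornerN hornerC subr_eq0 => /eqP.
Qed.

(** * Derivations and generalized eigenspaces *)

Section Derivation.
Variables (F : fieldType) (n : nat) (A : 'M[F]_n.+1).
Variable br : 'rV[F]_n.+1 -> 'rV[F]_n.+1 -> 'rV[F]_n.+1.
Hypothesis brl : forall v, linear (br^~ v).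
Hypothesis brr : forall u, linear (br u).
Hypothesis brA : forall u v, br u v *m A = br (u *m A) v + br u (v *m A).

Let br0l v : br 0 v = 0.
Proof. by have := brl v (-1) 0 0; rewrite scaler0 addr0 scaleN1r addNr. Qed.
Let br0r u : br u 0 = 0.
Proof. by have := brr u (-1) 0 0; rewrite scaler0 addr0 scaleN1r addNr. Qed.

(** Applying [A - (a + b)] to [br u v] gives a term with smaller [i] and one with smaller [j]; once
    either exponent is exhausted, an argument of [br] is zero. *)
Lemma geigenvector_bracket a b k : forall i j u v, (i + j <= k)%N ->
  u *m (A - a%:M) ^+ i = 0 -> v *m (A - b%:M) ^+ j = 0 ->
  br u v *m (A - (a + b)%:M) ^+ k = 0.
Proof.
elim: k => [|k IH] i j u v.
  rewrite leqn0 addn_eq0 => /andP[/eqP -> _].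
  by rewrite expr0 mulmx1 => -> _; rewrite br0l mul0mx.
case: i => [|i]; first by rewrite expr0 mulmx1 => _ -> _; rewrite br0l mul0mx.
case: j => [|j]; first by rewrite expr0 mulmx1 => _ _ ->; rewrite br0r mul0mx.
move=> le; rewrite !exprS -!mulmxE !mulmxA => u0 v0.
have -> : br u v *m (A - (a + b)%:M) =
    br (u *m (A - a%:M)) v + br u (v *m (A - b%:M)).
  rewrite !mulmxBr brA !mul_mx_scalar.
  have -> : br (u *m A - a *: u) v = br (u *m A) v - a *: br u v.
    by rewrite addrC -scaleNr brl scaleNr addrC.
  have -> : br u (v *m A - b *: v) = br u (v *m A) - b *: br u v.
    by rewrite addrC -scaleNr brr scaleNr addrC.
  by rewrite scalerDl opprD addrACA.
have le' : ((i + j).+1 <= k)%N by move: le; rewrite addSn addnS ltnS.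
rewrite mulmxDl (IH i j.+1) ?addnS // ?(IH i.+1 j) ?addSn ?addr0 //.
  by rewrite exprS -mulmxE mulmxA.
by rewrite exprS -mulmxE mulmxA.
Qed.

End Derivation.

Lemma horner_XsubC_exp (F : fieldType) n (A : 'M[F]_n.+1) a k :
  horner_mx A (('X - a%:P) ^+ k) = (A - a%:M) ^+ k.
Proof. by rewrite rmorphXn rmorphB /= horner_mx_X horner_mx_C. Qed.

Lemma mul_horner_congr (F : fieldType) n (A : 'M[F]_n.+1) (q : {poly F}) a c k
    (u : 'rV_n.+1) :
  ('X - a%:P) ^+ k %| q - c%:P -> u *m (A - a%:M) ^+ k = 0 ->
  u *m horner_mx A q = c *: u.
Proof.
move=> /dvdpP[g E] u0; have -> : q = ('X - a%:P) ^+ k * g + c%:P.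
  by rewrite mulrC -E subrK.
rewrite rmorphD rmorphM /= horner_mx_C mulmxDr mul_mx_scalar -mulmxE mulmxA.
by rewrite horner_XsubC_exp u0 mul0mx add0r.
Qed.

(* q is congruent to the conjugate of a modulo a high power of X - a, for a running
   through the eigenvalues of A and the sums of two of them, so that q(A) is the
   conjugate of the semisimple part of A. *)
Lemma exists_conj_poly (C : numClosedFieldType) n (A : 'M[C]_n.+1) :
  exists q : {poly C},
    (forall br : 'rV[C]_n.+1 -> 'rV[C]_n.+1 -> 'rV[C]_n.+1,
       (forall v, linear (br^~ v)) -> (forall u, linear (br u)) ->
       (forall u v, br u v *m A = br (u *m A) v + br u (v *m A)) ->
       forall u v, br u v *m horner_mx A q =
         br (u *m horner_mx A q) v + br u (v *m horner_mx A q)) /\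
    (\tr (A *m horner_mx A q) = 0 -> A ^+ n.+1 = 0).
Proof.
have [r Er] := char_poly_split A.
have sr : size r = n.+1.
  by apply: succn_inj; rewrite -(size_prod_XsubC r id) -Er size_char_poly.
pose k := n.+1; pose s := undup r.
have A0 : horner_mx A (\prod_(a <- s) ('X - a%:P) ^+ k) = 0.
  suff /dvdpP[g ->] : char_poly A %| \prod_(a <- s) ('X - a%:P) ^+ k.
    by rewrite rmorphM /= Cayley_Hamilton mulr0.
  rewrite Er -prodr_undup_exp_count; elim/big_rec2: _ => // a p p' _ dp.
  by rewrite dvdp_mul // dvdp_exp2l // /k -sr count_size.
(* The exponent is [k + k] because the bracket of two generalized eigenvectors is only known to be
   killed by that power. *)
have [q qP] := poly_crt (fun a : C => a^*) (k + k)
  (undup_uniq (s ++ [seq a + b | a <- s, b <- s])).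
have qs a : a \in s -> ('X - a%:P) ^+ (k + k) %| q - (a^*)%:P.
  by move=> sa; apply: qP; rewrite mem_undup mem_cat sa.
have qss a b : a \in s -> b \in s ->
    ('X - (a + b)%:P) ^+ (k + k) %| q - ((a + b)^*)%:P.
  by move=> sa sb; apply: qP; rewrite mem_undup mem_cat allpairs_f ?orbT.
exists q; set Y := horner_mx A q.
have Ys a (u : 'rV_n.+1) : a \in s -> u *m (A - a%:M) ^+ k = 0 -> u *m Y = a^* *: u.
  move=> sa u0; apply: (mul_horner_congr (qs a sa)).
  by rewrite exprD -mulmxE mulmxA u0 mul0mx.
split=> [br brl brr brA u v|tr0].
  have us : uniq s by apply: undup_uniq.
  have L (f : 'rV[C]_n.+1 -> 'rV[C]_n.+1) : linear f -> forall w, w *m lin1_mx f = f w.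
    by move=> lf w; exact: (mul_rV_lin1 (linear_pack lf)).
  (* The defect [d] of the derivation rule is bilinear, so it suffices that it vanishes on pairs of
     generalized eigenvectors. *)
  pose d (u v : 'rV_n.+1) := br u v *m Y - br (u *m Y) v - br u (v *m Y).
  have dl w : linear (d^~ w).
    move=> c x y; rewrite /d !(brl, mulmxDl) -!scalemxAl brl.
    by rewrite !scalerBr !opprD [X in X + _ = _]addrACA [LHS]addrACA.
  have dr w : linear (d w).
    move=> c x y; rewrite /d !(brr, mulmxDl) -!scalemxAl brr.
    by rewrite !scalerBr !opprD [X in X + _ = _]addrACA [LHS]addrACA.
  suff E : d u v = 0.
    by apply/eqP; rewrite -subr_eq0 opprD addrA; apply/eqP.
  have -> : d u v = v *m lin1_mx (d u) by rewrite L.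
  rewrite (geigenvectors_ext (B := lin1_mx (d u)) us A0) ?mulmx0 //.
  move=> b {}v sb; rewrite horner_XsubC_exp L // => vb.
  have -> : d u v = u *m lin1_mx (d^~ v) by rewrite L.
  rewrite (geigenvectors_ext (B := lin1_mx (d^~ v)) us A0) ?mulmx0 //.
  move=> a {}u sa; rewrite horner_XsubC_exp L // => ua.
  have w0 := geigenvector_bracket brl brr brA (leqnn _) ua vb.
  (* [Y] multiplies the bracket by the conjugate of [a + b], and conjugation is additive. *)
  rewrite /d (mul_horner_congr (qss a b sa sb) w0) (Ys a) // (Ys b) //.
  have -> : br (a^* *: u) v = a^* *: br u v.
    by have := brl v a^* u 0; rewrite addr0 (lin0 (brl v)) addr0.
  have -> : br u (b^* *: v) = b^* *: br u v.
    by have := brr u b^* v 0; rewrite addr0 (lin0 (brr u)) addr0.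
  by rewrite -addrA -opprD -scalerDl -rmorphD subrr.
(* The eigenvalues of [A *m Y] are the numbers [a * a^*], which are nonnegative; as they sum to
   zero, every eigenvalue of [A] is zero. *)
have AY : A *m Y = horner_mx A ('X * q) by rewrite rmorphM /= horner_mx_X.
have evA a : eigenvalue A a = (a \in s).
  by rewrite eigenvalue_root_char Er root_prod_XsubC mem_undup.
have ev a : a \in s -> ('X * q).[a] = a * a^*.
  move=> /qs; rewrite hornerM hornerX => /dvdpP[g E]; congr (_ * _).
  have -> : q = g * ('X - a%:P) ^+ (k + k) + (a^*)%:P by rewrite -E subrK.
  by rewrite !hornerE subrr expr0n mulr0 add0r.
have [t Et] := char_poly_split (A *m Y).
have tP z : z \in t -> exists2 a, a \in s & z = a * a^*.
  rewrite -root_prod_XsubC -Et -eigenvalue_root_char AY => /eigenvalue_horner[a].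
  by rewrite evA => sa <-; exists a => //; rewrite ev.
have t0 z : z \in t -> z = 0.
  have t_ge0 y : y \in t -> 0 <= y by move=> /tP[a _ ->]; apply: mul_conjC_ge0.
  move: tr0; rewrite (mxtrace_roots Et) big_seq => /eqP.
  rewrite psumr_eq0 // => /allP t0 /[dup] zt /t0; rewrite zt => /eqP //.
have s0 a : a \in s -> a = 0.
  move=> sa; have : eigenvalue (A *m Y) (a * a^*).
    have := sa; rewrite -evA => /eigenvalueP[v vA v0]; apply/eigenvalueP; exists v => //.
    rewrite mulmxA vA -scalemxAl (Ys a) ?scalerA //.
    by rewrite exprS -mulmxE mulmxA mulmxBr vA mul_mx_scalar subrr mul0mx.
  rewrite eigenvalue_root_char Et root_prod_XsubC => /t0 /eqP.
  by rewrite mul_conjC_eq0 => /eqP.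
have := Cayley_Hamilton A; suff -> : char_poly A = 'X^(n.+1).
  by rewrite rmorphXn /= horner_mx_X.
rewrite Er -sr big_seq (eq_bigr (fun=> 'X)) => [|z zr].
  by rewrite -big_seq big_const_seq count_predT iter_mulr_1.
by rewrite (s0 z) ?mem_undup // subr0.
Qed.

(** * Endomorphisms, their matrices and traces *)

Section LinearEndomorphisms.
Variables (K : fieldType) (V : vectType K).

Definition ltrace (f : 'End(V)) : K := \tr (f2mx f).

Lemma lfun_r2vE (f : 'End(V)) u : f u = r2v (v2r u *m f2mx f).
Proof. by rewrite unlock. Qed.

Lemma mul_f2mx (f : 'End(V)) u : u *m f2mx f = v2r (f (r2v u)).
Proof. by rewrite lfun_r2vE !r2vK. Qed.

Lemma f2mx_comp (f g : 'End(V)) : f2mx (f \o g)%VF = f2mx g *m f2mx f.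
Proof.
by apply/row_matrixP => i; rewrite !rowE mulmxA !mul_f2mx lfunE /= v2rK.
Qed.

Lemma f2mxP c (f g : 'End(V)) : f2mx (c *: f + g) = c *: f2mx f + f2mx g.
Proof.
apply/row_matrixP => i; rewrite !rowE mulmxDr -scalemxAr !mul_f2mx.
by rewrite lfunE /= lfunE /= linearP.
Qed.

Lemma ltrace_is_linear : linear (ltrace : 'End(V) -> K^o).
Proof. by move=> c f g; rewrite /ltrace f2mxP linearP. Qed.

Lemma ltraceC (f g : 'End(V)) : ltrace (f \o g)%VF = ltrace (g \o f)%VF.
Proof. by rewrite /ltrace !f2mx_comp mxtrace_mulC. Qed.

Lemma ltraceD (f g : 'End(V)) : ltrace (f + g) = ltrace f + ltrace g.
Proof. exact: (linD ltrace_is_linear). Qed.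

Lemma ltraceB (f g : 'End(V)) : ltrace (f - g) = ltrace f - ltrace g.
Proof. exact: (linB ltrace_is_linear). Qed.

End LinearEndomorphisms.

Lemma exists_conj_mx (C : numClosedFieldType) n (A : 'M[C]_n) :
  exists Y : 'M[C]_n,
    (forall br : 'rV[C]_n -> 'rV[C]_n -> 'rV[C]_n,
       (forall v, linear (br^~ v)) -> (forall u, linear (br u)) ->
       (forall u v, br u v *m A = br (u *m A) v + br u (v *m A)) ->
       forall u v, br u v *m Y = br (u *m Y) v + br u (v *m Y)) /\
    (\tr (A *m Y) = 0 -> exists N, forall u : 'rV_n, iter N (mulmx^~ A) u = 0).
Proof.
case: n A => [|n] A.
  exists 0; split=> [br _ _ _ u v|_]; first by rewrite [LHS]thinmx0 [RHS]thinmx0.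
  by exists 0%N => u; rewrite [LHS]thinmx0.
have [q [qd q0]] := exists_conj_poly A; exists (horner_mx A q); split=> // /q0 A0.
exists n.+1 => u; have iterE m : iter m (mulmx^~ A) u = u *m A ^+ m.
  elim: m => [|m IH]; first by rewrite expr0 mulmx1.
  by rewrite iterS IH exprSr -mulmxE mulmxA.
by rewrite iterE A0 mulmx0.
Qed.

Lemma exists_conj_end (C : numClosedFieldType) (V : vectType C) (f : 'End(V)) :
  exists y : 'End(V),
    (forall br : V -> V -> V, (forall v, linear (br^~ v)) -> (forall u, linear (br u)) ->
       (forall u v, f (br u v) = br (f u) v + br u (f v)) ->
       forall u v, y (br u v) = br (y u) v + br u (y v)) /\
    (ltrace (f \o y)%VF = 0 -> exists N, forall u, iter N f u = 0).
Proof.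
have [Y [Yd Y0]] := exists_conj_mx (f2mx f); exists (Hom Y).
split=> [br brl brr brf u v|].
  pose b x z := v2r (br (r2v x) (r2v z)).
  have bl z : linear (b^~ z) by move=> c x x'; rewrite /b linearP brl linearP.
  have b_r z : linear (b z) by move=> c x x'; rewrite /b linearP brr linearP.
  have bf x z : b x z *m f2mx f = b (x *m f2mx f) z + b x (z *m f2mx f).
    rewrite /b -linearD; apply: (can_inj r2vK); rewrite -lfun_r2vE brf v2rK.
    by rewrite !lfun_r2vE !r2vK.
  have := Yd b bl b_r bf (v2r u) (v2r v); rewrite /b !v2rK => E.
  by rewrite !lfun_r2vE /= E linearD /= !v2rK.
(* Matrices act on row vectors, so composition reverses the product; the trace is unaffected. *)
rewrite /ltrace f2mx_comp /= mxtrace_mulC => /Y0[N E]; exists N => u.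
have -> : iter N f u = r2v (iter N (mulmx^~ (f2mx f)) (v2r u)).
  elim: N {E} => [|N IH] /=; first by rewrite v2rK.
  by rewrite IH lfun_r2vE r2vK.
by rewrite E linear0.
Qed.

(** * Lie algebras *)

Lemma lieb_derivation (K : fieldType) (G : lieAlgType K) (x y z : G) :
  lieb x (lieb y z) = lieb (lieb x y) z + lieb y (lieb x z).
Proof.
have /eqP := lieb_jacobi x y z; rewrite (lieb_anti z x) (lieb_anti z).
by rewrite (linN (lieb_linearr y)) subr_eq0 subr_eq addrC => /eqP.
Qed.

(** * Engel's theorem *)

Section Engel.
Variables (K : fieldType) (G : finLieAlgType K).

(* The condition on U says that H has a nonzero invariant vector in G / U; if it holds
   for H, then the case U = H gives v such that H + <v> is a subalgebra. *)
Lemma engel_chain (nil : forall z : G, exists N, forall u, iter N (lieb z) u = 0) k :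
  (k <= dim G)%N -> exists H : {vspace G}, [/\ \dim H = k,
    forall x y, x \in H -> y \in H -> lieb x y \in H &
    forall U : {vspace G}, (forall h u, h \in H -> u \in U -> lieb h u \in U) ->
      U != fullv -> exists v, v \notin U /\ forall h, h \in H -> lieb h v \in U].
Proof.
have notfull (U : {vspace G}) : U != fullv -> exists v, v \notin U.
  rewrite eqEsubv subvf /= => /subvPn[v _ vU]; by exists v.
elim: k => [_|k IH lt].
  exists 0%VS; split=> [|x y|U _ /notfull[v vU]]; first exact: dimv0.
    by rewrite !memv0 => /eqP -> _; rewrite (lin0 (lieb_linearl y)).
  by exists v; split=> // h; rewrite memv0 => /eqP ->; rewrite (lin0 (lieb_linearl v)) mem0v.
have [H [dH subH engH]] := IH (ltnW lt).
have [v [vH Hv]] : exists v, v \notin H /\ forall h, h \in H -> lieb h v \in H.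
  by apply: engH => //; apply: contraTneq lt => HE; rewrite -dH HE dimvf ltnn.
have vH' h : h \in H -> lieb v h \in H.
  by move=> hH; rewrite lieb_anti memvN Hv.
have decomp x : x \in (H + <[v]>)%VS -> exists h c, h \in H /\ x = h + c *: v.
  by move=> /memv_addP[h hH [_ /vlineP[c ->] ->]]; exists h, c.
exists (H + <[v]>)%VS; split.
- rewrite dimv_disjoint_sum ?dH.
    by rewrite dim_vline (memPnC vH) ?mem0v // addn1.
  apply/eqP; rewrite -subv0; apply/subvP => x /memv_capP[xH /vlineP[c xE]].
  rewrite memv0; move: xH; rewrite xE; have [->|c0] := eqVneq c 0.
    by rewrite scale0r eqxx.
  by rewrite rpredZeq (negPf c0) (negPf vH).
- move=> _ _ /decomp[x [c [xH ->]]] /decomp[y [d [yH ->]]].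
  rewrite (linD (lieb_linearl _)) !(linD (lieb_linearr _)).
  rewrite !(linZ _ (lieb_linearl _)) !(linZ _ (lieb_linearr _)) lieb_alt !scaler0 addr0.
  apply: (subvP (addvSl _ _)); apply: memvD; last by apply/memvZ/vH'.
  by apply: memvD; [apply: subH | apply/memvZ/Hv].
move=> U stU Ufull.
have [w0 [w0U Hw0]] : exists w, w \notin U /\ forall h, h \in H -> lieb h w \in U.
  by apply: engH => // h u hH; apply: stU; apply: (subvP (addvSl _ _)).
have vU u : u \in U -> lieb v u \in U.
  by apply: stU; apply: (subvP (addvSr _ _)); apply: memv_line.
(* As [[h, [v, w]] = [[h, v], w] + [v, [h, w]]] with [[h, v]] in [H], the iterates of [ad v] on [w0]
   are still sent into [U] by [H]. *)
have Hw j h : h \in H -> lieb h (iter j (lieb v) w0) \in U.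
  elim: j h => [|j IHj] h hH /=; first exact: Hw0.
  by rewrite lieb_derivation memvD ?IHj ?Hv // vU ?IHj.
have [N N0] := nil v.
(* The iterate just before the first one in [U] is sent into [U] by [v] as well. *)
have ex : exists j, iter j (lieb v) w0 \in U by exists N; rewrite N0 mem0v.
case: (ex_minnP ex) => -[|j]; first by rewrite /= (negPf w0U).
move=> jU jmin; exists (iter j (lieb v) w0); split.
  by apply/negP => /jmin; rewrite ltnn.
move=> _ /decomp[h [c [hH ->]]].
by rewrite (linD (lieb_linearl _)) (linZ _ (lieb_linearl _)) memvD ?Hw ?memvZ.
Qed.

(** For [k = dim G] the subalgebra of [engel_chain] is all of [G], and its property at [U = 0]
    yields the vector. *)
Lemma engel : (forall z : G, exists N, forall u, iter N (lieb z) u = 0) ->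
  (0 < dim G)%N -> exists2 v : G, v != 0 & forall z, lieb z v = 0.
Proof.
move=> nil G0; have [H [dH _ engH]] := engel_chain nil (leqnn _).
have HE : H = fullv by apply/eqP; rewrite eqEdim subvf dH dimvf leqnn.
have stab0 h u : h \in H -> u \in 0%VS -> lieb h u \in 0%VS.
  by rewrite !memv0 => _ /eqP ->; rewrite (lin0 (lieb_linearr h)).
have full0 : 0%VS != fullv :> {vspace G} by rewrite eq_sym -dimv_eq0 dimvf -lt0n.
have [v [v0 vE]] := engH 0%VS stab0 full0.
exists v; first by rewrite -memv0.
by move=> z; apply/eqP; rewrite -memv0 vE // HE memvf.
Qed.

End Engel.

(** * Simple Lie algebras and the Killing form *)

Section SimpleLie.
Variables (K : fieldType) (G : finLieAlgType K).
Hypothesis simpleG : lie_simple G.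

(** A subspace containing all brackets is an ideal, and it is nonzero since [G] is not abelian. *)
Lemma lie_simple_perfect (W : {vspace G}) : (forall x y, lieb x y \in W) -> W = fullv.
Proof.
move=> Wbr; have [W0|//] := simpleG.2 W (fun x y _ => Wbr x y).
by have [x [y]] := simpleG.1; rewrite -memv0 -W0 Wbr.
Qed.

(** The kernel of [f] contains all brackets. Identities linear in a variable thus need checking only
    when that variable is a bracket. *)
Lemma lie_simple_ext (V : vectType K) (f : G -> V) : linear f ->
  (forall x y, f (lieb x y) = 0) -> forall x, f x = 0.
Proof.
move=> lf f0 x; pose F := linfun (linear_pack lf).
have FE z : F z = f z by rewrite lfunE.
suff : x \in lker F by rewrite memv_ker FE => /eqP.
by rewrite (lie_simple_perfect (W := lker F)) ?memvf // => y z; rewrite memv_ker FE f0.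
Qed.

(** The line through a central [c] is an ideal, and it cannot be all of the nonabelian [G]. *)
Lemma lie_simple_center (c : G) : (forall z, lieb z c = 0) -> c = 0.
Proof.
move=> c0; case: (simpleG.2 <[c]>%VS) => [x _ /vlineP[k ->]|E|E].
- by rewrite (linZ _ (lieb_linearr x)) c0 scaler0 mem0v.
- by apply/eqP; rewrite -memv0 -E memv_line.
have [x [y /eqP[]]] := simpleG.1; have : y \in <[c]>%VS by rewrite E memvf.
by move=> /vlineP[k ->]; rewrite (linZ _ (lieb_linearr x)) c0 scaler0.
Qed.

Lemma lie_simple_dim : (0 < dim G)%N.
Proof.
have [x [y xy0]] := simpleG.1; rewrite -dimvf lt0n dimv_eq0.
by apply: contraNneq xy0 => E; rewrite -memv0 -E memvf.
Qed.

Definition adE (x : G) : 'End(G) := linfun (linear_pack (lieb_linearr x)).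

Lemma adEE x y : adE x y = lieb x y.
Proof. by rewrite lfunE. Qed.

Lemma adE_is_linear : linear adE.
Proof.
move=> c x y; apply/lfunP => z; rewrite add_lfunE scale_lfunE !adEE.
exact: lieb_linearl.
Qed.

Lemma adE_lieb x y : adE (lieb x y) = ((adE x \o adE y) - (adE y \o adE x))%VF.
Proof.
apply/lfunP => z; rewrite add_lfunE opp_lfunE !comp_lfunE !adEE.
by rewrite (lieb_derivation x y) addrK.
Qed.

Definition killing (x y : G) : K := ltrace (adE x \o adE y)%VF.

Lemma killingC x y : killing x y = killing y x.
Proof. exact: ltraceC. Qed.

Lemma killing_linearr x : linear (killing x : G -> K^o).
Proof.
by move=> c y z; rewrite /killing adE_is_linear comp_lfunDr -comp_lfunZr ltrace_is_linear.
Qed.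

Lemma killing_linearl y : linear (killing^~ y : G -> K^o).
Proof.
by move=> c x z; rewrite /killing adE_is_linear comp_lfunDl -comp_lfunZl ltrace_is_linear.
Qed.

Definition killing_form (x : G) : 'Hom(G, K^o) := linfun (linear_pack (killing_linearr x)).

Lemma killing_formE x y : killing_form x y = killing x y.
Proof. by rewrite lfunE. Qed.

Lemma killing_form_is_linear : linear killing_form.
Proof.
move=> c x z; apply/lfunP => y; rewrite add_lfunE scale_lfunE !killing_formE.
exact: killing_linearl.
Qed.

(** The hypothesis means [[ad v, d] = - ad (d v)], and [tr ([ad u, ad v] d) = tr (ad u [ad v, d])]
    by cyclicity. The case [d = ad z] gives invariance of the Killing form; another derivation is
    used in Cartan's criterion. *)
Lemma ltrace_derivation (d : 'End(G)) u v :
  (forall w, d (lieb v w) = lieb (d v) w + lieb v (d w)) ->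
  ltrace (adE (lieb u v) \o d)%VF = - killing u (d v).
Proof.
move=> dv; have E : (adE v \o d)%VF = (d \o adE v)%VF - adE (d v).
  apply/lfunP => w; rewrite add_lfunE opp_lfunE !comp_lfunE !adEE dv.
  by rewrite addrAC subrr add0r.
have cyc : ltrace (adE v \o (adE u \o d))%VF = ltrace (adE u \o (d \o adE v))%VF.
  by rewrite ltraceC comp_lfunA.
rewrite adE_lieb comp_lfunDl comp_lfunNl -!comp_lfunA E ltraceB cyc comp_lfunDr.
by rewrite comp_lfunNr ltraceB addrAC subrr add0r.
Qed.

Lemma killing_lieb x y z : killing (lieb x y) z = killing x (lieb y z).
Proof.
rewrite /killing (ltrace_derivation (d := adE z)) => [|w].
  rewrite adEE lieb_anti /killing.
  by rewrite -[- lieb y z]scaleN1r (linZ _ adE_is_linear) -comp_lfunZr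
     (linZ _ (@ltrace_is_linear _ _)) scaleN1r opprK.
by rewrite !adEE lieb_derivation.
Qed.

End SimpleLie.

(** * Schur's lemma, Cartan's criterion and triple derivations *)

Section SimpleLieClosed.
Variables (C : numClosedFieldType) (G : finLieAlgType C).
Hypothesis simpleG : lie_simple G.

(** Over an algebraically closed field [f] has an eigenvalue [k], and the kernel of [f - k] is a
    nonzero ideal. *)
Lemma lie_simple_schur (f : G -> G) : linear f ->
  (forall a b, f (lieb a b) = lieb a (f b)) -> exists k, forall a, f a = k *: a.
Proof.
move=> lf fbr; pose F := linfun (linear_pack lf).
have FE z : F z = f z by rewrite lfunE.
have [k /eigenvalueP[v vE v0]] := eigenvalue_closed (f2mx F) (lie_simple_dim simpleG).
exists k; pose I := lker (F - k *: (\1%VF : 'End(G))); have memI x : (x \in I) = (f x == k *: x).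
  by rewrite memv_ker add_lfunE opp_lfunE scale_lfunE id_lfunE FE subr_eq0.
have [x y|I0|IG a] := simpleG.2 I.
- by rewrite !memI fbr => /eqP ->; rewrite (linZ _ (lieb_linearr x)).
- have : r2v v \in I by rewrite memI -FE lfun_r2vE r2vK vE linearZ.
  by rewrite I0 memv0 -(linear0 (@r2v _ G)) (inj_eq (can_inj r2vK)) (negPf v0).
by apply/eqP; rewrite -memI IG memvf.
Qed.

(* If the form vanishes, let y be the conjugate of the semisimple part of ad z, which is
   a derivation. As z is a sum of brackets, the trace of (ad z) y vanishes, so ad z is
   nilpotent. *)
Lemma killing_nondegenerate (x : G) : (forall y, killing x y = 0) -> x = 0.
Proof.
pose kapL := linfun (linear_pack (@killing_form_is_linear _ G)).
have mem z : z \in lker kapL <-> forall y, killing z y = 0.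
  rewrite memv_ker lfunE /=; split=> [/eqP E y|E].
    by rewrite -killing_formE E lfunE.
  by apply/eqP/lfunP => y; rewrite killing_formE E lfunE.
(* The radical of the form is an ideal by invariance. Were it all of [G], Engel's theorem would give
   a nonzero central vector. *)
move=> /mem x0; have [z y|R0|RG] := simpleG.2 (lker kapL).
- move=> yk; apply/mem => w; have y0 := (mem y).1 yk. by rewrite killingC -killing_lieb killingC y0.
- by apply/eqP; rewrite -memv0 -R0.
have B0 (z y : G) : killing z y = 0 by apply: (mem z).1; rewrite RG memvf.
case: (engel (G := G)) => [z||v v0 vE]; last 1 first.
- by rewrite (lie_simple_center simpleG vE) eqxx in v0.
- have [y [yd]] := exists_conj_end (adE z).
  suff -> : ltrace (adE z \o y)%VF = 0.
    move=> /(_ erefl)[N E]; exists N => u; rewrite -[RHS](E u).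
    by apply: eq_iter => w; rewrite adEE.
  have ly : linear (fun z => ltrace (adE z \o y)%VF : C^o).
    by move=> c a b; rewrite adE_is_linear comp_lfunDl -comp_lfunZl ltrace_is_linear.
  apply: (lie_simple_ext simpleG ly) => a b /=.
  have zd u w : adE z (lieb u w) = lieb (adE z u) w + lieb u (adE z w).
    by rewrite !adEE lieb_derivation.
  rewrite ltrace_derivation ?B0 ?oppr0 // => w.
  exact: (yd lieb (@lieb_linearl C G) (@lieb_linearr C G) zd).
- exact: lie_simple_dim.
Qed.

(** Nondegeneracy makes [killing_form] injective into the dual of [G], which has the same
    dimension. *)
Lemma killing_representation (l : G -> C^o) : linear l ->
  exists e, forall y, l y = killing e y.
Proof.
move=> ll; pose L := linfun (linear_pack ll) : 'Hom(G, C^o).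
pose kapL := linfun (linear_pack (@killing_form_is_linear _ G)).
have ker0 : lker kapL = 0%VS.
  apply/eqP; rewrite -subv0; apply/subvP => x; rewrite memv_ker memv0 lfunE /=.
  move=> /eqP kx; apply/eqP/killing_nondegenerate => y.
  by rewrite -killing_formE kx lfunE.
have : L \in limg kapL.
  suff -> : limg kapL = fullv by rewrite memvf.
  apply/eqP; rewrite eqEdim subvf /= dimvf.
  have := limg_ker_dim kapL fullv; rewrite ker0 capv0 dimv0 add0n => ->.
  by rewrite dimvf /dim /= muln1.
move=> /memv_imgP[e _ E]; exists e => y.
by rewrite -killing_formE -[l y](lfunE (linear_pack ll)) -/L E lfunE.
Qed.

(* Subtracting ad e, one may assume that tr (d (ad y)) = 0 for all y; then
   [d a, b] + [a, d b] = 0 by the nondegeneracy of the Killing form. *)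
Lemma triple_derivation_inner (d : 'End(G)) :
  (forall a b c, d (lieb (lieb a b) c) =
     lieb (lieb (d a) b) c + lieb (lieb a (d b)) c + lieb (lieb a b) (d c)) ->
  exists e, forall a, d a = lieb e a.
Proof.
move=> dt; have ll : linear (fun y => ltrace (d \o adE y)%VF : C^o).
  by move=> c a b; rewrite adE_is_linear comp_lfunDr -comp_lfunZr ltrace_is_linear.
have [e eP] := killing_representation ll; exists e.
pose f := d - adE e; have fE a : f a = d a - lieb e a by rewrite add_lfunE opp_lfunE adEE.
suff f0 a : f a = 0 by move=> a; apply/eqP; rewrite -subr_eq0 -fE f0.
have ft a' b c : f (lieb (lieb a' b) c) =
     lieb (lieb (f a') b + lieb a' (f b)) c + lieb (lieb a' b) (f c).
  rewrite !fE dt lieb_derivation (lieb_derivation e a').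
  rewrite (linB (lieb_linearl _)) !(linB (lieb_linearr _)) !(linD (lieb_linearl _)).
  rewrite !(linN (lieb_linearl _)) !opprD.
  by rewrite addrACA; congr (_ + _); rewrite addrACA.
have tr0 y : ltrace (f \o adE y)%VF = 0.
  by rewrite comp_lfunDl comp_lfunNl ltraceB eP subrr.
(* By the triple rule [ad X] is the commutator of [f] and [ad [a', b]], so [tr (ad X ad v)] equals
   [tr (f ad [[a', b], v])], which is zero. *)
have star a' b : lieb (f a') b + lieb a' (f b) = 0.
  apply: killing_nondegenerate => v; set X := (X in killing X).
  have adX : adE X = ((f \o adE (lieb a' b)) - (adE (lieb a' b) \o f))%VF.
    apply/lfunP => c; rewrite add_lfunE opp_lfunE !comp_lfunE !adEE ft.
    by rewrite addrK.
  rewrite /killing adX comp_lfunDl comp_lfunNl ltraceB.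
  have cyc : ltrace ((adE (lieb a' b) \o f) \o adE v)%VF =
      ltrace (f \o (adE v \o adE (lieb a' b)))%VF.
    by rewrite -comp_lfunA ltraceC -comp_lfunA.
  rewrite cyc -comp_lfunA -ltraceB -comp_lfunNr -comp_lfunDr.
  by rewrite -adE_lieb tr0.
(* For a bracket [a'] this is the triple rule, whose first two terms cancel by [star]; brackets span
   [G]. *)
have fr a' b : f (lieb a' b) = lieb a' (f b).
  suff: forall x, f (lieb x b) - lieb x (f b) = 0.
    by move=> /(_ a')/eqP; rewrite subr_eq0 => /eqP.
  apply: (lie_simple_ext simpleG) => [c x y|x y].
    rewrite (lieb_linearl b) linearP (lieb_linearl (f b)).
    by rewrite scalerBr opprD addrACA.
  by rewrite ft star (lin0 (lieb_linearl b)) add0r subrr.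
(* Moving [f] to either side of [[z, a]] gives [[f z, a] = [z, f a]], so by [star] twice [[z, f a]]
   is zero. *)
apply: (lie_simple_center simpleG) => z.
have E : lieb (f z) a = lieb z (f a).
  by rewrite -fr lieb_anti -fr -linearN -lieb_anti.
have := star z a; rewrite E => /eqP; rewrite -mulr2n -scaler_nat scaler_eq0 pnatr_eq0 /=.
by move=> /eqP.
Qed.

End SimpleLieClosed.

(** * Evaluation at scalars *)

Section Evaluation.
Variables (K : fieldType) (M : choiceType) (V W : lmodType K).

Definition hev (h : M -> K) (f : V -> W) (u : tens M V) : W :=
  Defs.lift (fun m a => h m *: f a) u.

Lemma hev_is_linear h f : linear f -> linear (hev h f).
Proof. by move=> lf; apply: lift_is_linear => m; apply: lin_scale. Qed.

Lemma hevU h f a m : linear f -> hev h f (mon a m) = h m *: f a.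
Proof. by move=> lf; rewrite /hev liftU // (lin0 lf) scaler0. Qed.

End Evaluation.

Section EvaluationFree.
Variables (K : fieldType) (V : lmodType K).

(* the values of p(d) a at d = D, and of p(d, X) a at d = D, X = y *)
Definition ev1 (D : K) (u : cdfree V) : V := hev (fun i => D ^+ i) id u.

Definition ev2 (D y : K) (P : vpoly (cdfree V)) : V := hev (fun j => y ^+ j) (ev1 D) P.

Lemma ev1_is_linear D : linear (ev1 D).
Proof. exact/hev_is_linear/lin_id. Qed.

Lemma ev2_is_linear D y : linear (ev2 D y).
Proof. exact/hev_is_linear/ev1_is_linear. Qed.

Lemma ev1U D a i : ev1 D (mon a i) = D ^+ i *: a.
Proof. by rewrite /ev1 hevU. Qed.

Lemma ev1_gen D a : ev1 D (mon a 0%N) = a.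
Proof. by rewrite ev1U scale1r. Qed.

Lemma ev2U D y u j : ev2 D y (mon u j) = y ^+ j *: ev1 D u.
Proof. by rewrite /ev2 hevU //; apply: ev1_is_linear. Qed.

Lemma ev1_del D (u : cdfree V) : ev1 D (del u) = D *: ev1 D u.
Proof.
apply: (@tens_ext K nat V V (fun u : cdfree V => ev1 D (del u)) (fun u => D *: ev1 D u)).
- exact: (lin_comp (ev1_is_linear D) (@del_is_linear K (cdfree V))).
- exact/lin_scale/ev1_is_linear.
by move=> a i; rewrite -[del _]/(mulX _) mulXU !ev1U exprS scalerA.
Qed.

Lemma ev2_tmap_del D y (P : vpoly (cdfree V)) : ev2 D y (tmap del P) = D *: ev2 D y P.
Proof.
have dl := @del_is_linear K (cdfree V).
apply: (@tens_ext K nat (cdfree V) V (fun P => ev2 D y (tmap del P)) (fun P => D *: ev2 D y P)).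
- exact: (lin_comp (ev2_is_linear D y) (tmap_is_linear dl)).
- exact/lin_scale/ev2_is_linear.
by move=> a i; rewrite tmapU // !ev2U ev1_del !scalerA mulrC.
Qed.

Lemma ev2_mulX D y (P : vpoly (cdfree V)) : ev2 D y (mulX P) = y *: ev2 D y P.
Proof.
apply: (@tens_ext K nat (cdfree V) V (fun P => ev2 D y (mulX P)) (fun P => y *: ev2 D y P)).
- exact: (lin_comp (ev2_is_linear D y) (@mulX_is_linear K (cdfree V))).
- exact/lin_scale/ev2_is_linear.
by move=> a i; rewrite mulXU !ev2U scalerA exprS.
Qed.

Lemma ev2_ptens D y p (u : cdfree V) : ev2 D y (ptens p u) = p.[y] *: ev1 D u.
Proof.
have l2 := ev2_is_linear D y; rewrite /ptens (big_morph _ (linD l2) (lin0 l2)).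
rewrite horner_coef scaler_suml; apply: eq_bigr => i _.
by rewrite ev2U (linZ _ (ev1_is_linear D)) scalerA mulrC.
Qed.

Section Extended.
Variables (M : conomType) (h : {mmorphism M -> K}).

Definition evA (p : {malg K[M]}) : K := mmap idfun h p.

Definition ev3 (D : K) (u : tens M (cdfree V)) : V := hev h (ev1 D) u.

Lemma ev3_is_linear D : linear (ev3 D).
Proof. exact/hev_is_linear/ev1_is_linear. Qed.

Lemma ev3U D u m : ev3 D (mon u m) = h m *: ev1 D u.
Proof. by rewrite /ev3 hevU //; apply: ev1_is_linear. Qed.

Lemma ev3_one D u : ev3 D (mon u mone) = ev1 D u.
Proof. by rewrite ev3U mmorph1 scale1r. Qed.

Lemma ev3_amul D p u : ev3 D (amul p u) = evA p *: ev3 D u.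
Proof.
have l3 := ev3_is_linear D.
apply: (@tens_ext K M (cdfree V) V (fun u => ev3 D (amul p u)) (fun u => evA p *: ev3 D u)).
- exact: (lin_comp l3 (amul_linr p)).
- exact/lin_scale/l3.
move=> a k; rewrite [in LHS](monalgE p) amul_suml (big_morph _ (linD l3) (lin0 l3)).
rewrite /evA mmapE scaler_suml; apply: eq_bigr => m _.
by rewrite amulUU !ev3U mmorphM (linZ _ (ev1_is_linear D)) !scalerA mulrC mulrA.
Qed.

Lemma ev3_subst D s P : ev3 D (subst s P) = ev2 D (evA s) P.
Proof.
apply: (@tens_ext K nat (cdfree V) V (fun P => ev3 D (subst s P)) (ev2 D (evA s))).
- exact: (lin_comp (ev3_is_linear D) (subst_is_linear s)).
- exact: ev2_is_linear.
by move=> a j; rewrite substU ev3_amul ev3_one ev2U /evA rmorphXn.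
Qed.

(** The points [D] and [D'] differ because brackets and conformal maps shift the value of [d]. *)
Lemma ev3_aext D D' (f : cdfree V -> tens M (cdfree V)) (F : V -> V) u :
  linear f -> linear F -> (forall a, ev3 D (f a) = F (ev1 D' a)) ->
  ev3 D (aext f u) = F (ev3 D' u).
Proof.
move=> lf lF E.
apply: (@tens_ext K M (cdfree V) V (fun u => ev3 D (aext f u)) (fun u => F (ev3 D' u))).
- exact: (lin_comp (ev3_is_linear D) (aext_is_linear lf)).
- exact: (lin_comp lF (ev3_is_linear D')).
move=> a m; rewrite aextU // ev3_amul E ev3U (linZ _ lF); congr (_ *: _).
by rewrite /evA mmapU mul1r.
Qed.

End Extended.

(* A sesquilinear bracket and a conformal linear map are determined by the values
   [lval] and [mval] of their polynomials on the generators. *)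
Section Bracket.
Variable br : cdfree V -> cdfree V -> vpoly (cdfree V).
Hypothesis brl : forall b, linear (br^~ b).
Hypothesis brr : forall a, linear (br a).
Hypothesis brdl : forall a b, br (del a) b = - mulX (br a b).
Hypothesis brdr : forall a b, br a (del b) = tmap del (br a b) + mulX (br a b).

Definition lval (D y : K) (a b : V) : V := ev2 D y (br (mon a 0%N) (mon b 0%N)).

Let m0 : linear (fun a : V => mon a 0%N : cdfree V).
Proof. exact: mon_is_linear. Qed.

Lemma lval_linearl D y b : linear ((lval D y)^~ b).
Proof. exact: (lin_comp (ev2_is_linear D y) (lin_comp (brl _) m0)). Qed.

Lemma lval_linearr D y a : linear (lval D y a).
Proof. exact: (lin_comp (ev2_is_linear D y) (lin_comp (brr _) m0)). Qed.

(** By sesquilinearity [d] acts as [- X] from the left argument and as [d + X] from the right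
    one. *)
Lemma ev2_br D y u v : ev2 D y (br u v) = lval D y (ev1 (- y) u) (ev1 (D + y) v).
Proof.
have l2 := ev2_is_linear D y.
move: u; apply: (cdfree_ext (f := fun u => ev2 D y (br u v))
  (g := fun u => lval D y (ev1 (- y) u) (ev1 (D + y) v))).
- exact: (lin_comp l2 (brl v)).
- exact: (lin_comp (lval_linearl _ _ _) (ev1_is_linear _)).
- move=> a; rewrite ev1_gen.
  move: v; apply: (cdfree_ext (f := fun v => ev2 D y (br (mon a 0%N) v))
    (g := fun v => lval D y a (ev1 (D + y) v))).
  + exact: (lin_comp l2 (brr _)).
  + exact: (lin_comp (lval_linearr _ _ _) (ev1_is_linear _)).
  + by move=> b; rewrite ev1_gen.
  + move=> v E; rewrite brdr (linD l2) ev2_tmap_del ev2_mulX E ev1_del.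
    by rewrite (linZ _ (lval_linearr _ _ _)) scalerDl.
- move=> u E; rewrite brdl (linN l2) ev2_mulX E ev1_del.
  by rewrite (linZ _ (lval_linearl _ _ _)) scaleNr.
Qed.

Lemma ev3_lbext (M : conomType) (h : {mmorphism M -> K}) D s u v :
  ev3 h D (lbext br s u v) =
  lval D (evA h s) (ev3 h (- evA h s) u) (ev3 h (D + evA h s) v).
Proof.
apply: (ev3_aext (F := fun a => lval D (evA h s) a (ev3 h (D + evA h s) v))).
- apply: lin_lift => m b; apply: (lin_comp (amul_linr _)).
  exact: (lin_comp (subst_is_linear s) (brl b)).
- exact: lval_linearl.
move=> a; apply: (ev3_aext (F := fun b => lval D (evA h s) (ev1 (- evA h s) a) b)).
- exact: (lin_comp (subst_is_linear s) (brr a)).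
- exact: lval_linearr.
by move=> b; rewrite ev3_subst ev2_br.
Qed.

End Bracket.

Section Map.
Variable phi : cdfree V -> vpoly (cdfree V).
Hypothesis phil : linear phi.
Hypothesis phid : forall a, phi (del a) = tmap del (phi a) + mulX (phi a).

Definition mval (D y : K) (a : V) : V := ev2 D y (phi (mon a 0%N)).

Lemma mval_linear D y : linear (mval D y).
Proof. exact: (lin_comp (ev2_is_linear D y) (lin_comp phil (mon_is_linear _))). Qed.

Lemma ev2_map D y u : ev2 D y (phi u) = mval D y (ev1 (D + y) u).
Proof.
have l2 := ev2_is_linear D y.
move: u; apply: (cdfree_ext (f := fun u => ev2 D y (phi u))
  (g := fun u => mval D y (ev1 (D + y) u))).
- exact: (lin_comp l2 phil).
- exact: (lin_comp (mval_linear _ _) (ev1_is_linear _)).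
- by move=> a; rewrite ev1_gen.
- move=> u E; rewrite phid (linD l2) ev2_tmap_del ev2_mulX E ev1_del.
  by rewrite (linZ _ (mval_linear _ _)) scalerDl.
Qed.

Lemma ev3_map (M : conomType) (h : {mmorphism M -> K}) D s u :
  ev3 h D (aext (fun a => subst s (phi a)) u) =
  mval D (evA h s) (ev3 h (D + evA h s) u).
Proof.
apply: ev3_aext; first exact: (lin_comp (subst_is_linear s) phil).
  exact: mval_linear.
by move=> a; rewrite ev3_subst ev2_map.
Qed.

End Map.

End EvaluationFree.

(** * Polynomial identities and injectivity of evaluation *)

Section PolynomialFunctions.
Variables (K : numFieldType) (W : lmodType K).

(* f(2x) - 2^N f(x) has degree less than N if f has degree N. *)
Lemma poly_fun_eq0 N (w : nat -> W) :
  (forall x : K, x != 0 -> \sum_(k < N) x ^+ k *: w k = 0) ->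
  forall k, (k < N)%N -> w k = 0.
Proof.
elim: N w => [//|N IH] w w0.
have wlt k : (k < N)%N -> w k = 0.
  move=> kN; have : (2 ^+ k - 2 ^+ N : K) *: w k = 0.
    apply: (IH (fun k => (2 ^+ k - 2 ^+ N) *: w k)) => // x x0.
    have := w0 (2 * x); rewrite mulf_neq0 ?pnatr_eq0 // => /(_ isT).
    have /(congr1 (fun u => 2 ^+ N *: u)) := w0 x x0.
    rewrite scaler0 => E1 E2; rewrite -[RHS](subrr 0) -[X in _ = X - _]E2 -[X in _ = _ - X]E1.
    rewrite scaler_sumr -sumrB big_ord_recr /= exprMn scalerA subrr addr0.
    apply: eq_bigr => i _; rewrite exprMn !scalerA -scalerBl; congr (_ *: _).
    by rewrite mulrBr mulrC [X in _ - X]mulrC.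
  move=> /eqP; rewrite scaler_eq0 subr_eq0 => /orP[|/eqP //].
  by rewrite lt_eqF // ltr_eXn2l ?ltr1n.
move=> k; rewrite ltnS leq_eqVlt => /orP[/eqP ->|]; last exact: wlt.
have := w0 1 (oner_neq0 _); rewrite big_ord_recr /= big1 ?add0r => [|i _].
  by rewrite expr1n scale1r.
by rewrite wlt ?scaler0.
Qed.

(** The terms of exponent [k] add up to one coefficient of a polynomial function. This separates one
    variable at a time. *)
Lemma sum_exp_eq0 (T : eqType) (s : seq T) (P : pred T) (e : T -> nat) (w : T -> W) :
  (forall x : K, x != 0 -> \sum_(t <- s | P t) x ^+ e t *: w t = 0) ->
  forall k, \sum_(t <- s | P t && (e t == k)) w t = 0.
Proof.
move=> w0 k; pose N := (\max_(t <- s) e t).+1.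
have ltN t : t \in s -> (e t < N)%N by move=> ts; rewrite ltnS; apply: leq_bigmax_seq.
have [kN|Nk] := ltnP k N; last first.
  rewrite big_seq_cond big1 // => t /andP[/ltN lt /andP[_ /eqP E]].
  by rewrite E ltnNge Nk in lt.
apply: (poly_fun_eq0 (w := fun k => \sum_(t <- s | P t && (e t == k)) w t)) kN => x x0.
rewrite -[RHS](w0 x x0) [RHS]big_seq_cond [RHS]big_mkcond /=.
under eq_bigr => i _ do rewrite scaler_sumr big_mkcond.
rewrite exchange_big /= [LHS]big_seq [RHS]big_seq; apply: eq_bigr => t ts; rewrite ts /=.
rewrite (bigD1 (Ordinal (ltN t ts))) //= eqxx andbT big1 ?addr0 // => i /negPf ne.
by rewrite [e t == i]eq_sym -[X in _ == X]/(val (Ordinal (ltN t ts))) val_eqE ne andbF.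
Qed.

End PolynomialFunctions.

Section EvaluationInjective.
Variables (K : numFieldType) (V : lmodType K).

Lemma hev_exp_eq0 (U : zmodType) (f : U -> V) (u : tens nat U) :
  (forall x : K, x != 0 -> Defs.lift (fun j a => x ^+ j *: f a) u = 0) ->
  f 0 = 0 -> forall k, f u@_k = 0.
Proof.
move=> u0 f0 k; have [kin|/mcoeff_outdom -> //] := boolP (k \in msupp u).
have u0' (x : K) : x != 0 -> \sum_(j <- msupp u) x ^+ j *: f u@_j = 0.
  by move=> x0; rewrite -[RHS](u0 x x0) liftE.
have := sum_exp_eq0 u0' k; rewrite /= (eq_bigl (pred1 k)) // -big_filter.
by rewrite filter_pred1_uniq ?fset_uniq // big_seq1.
Qed.

Lemma ev1_inj (u : cdfree V) : (forall D : K, D != 0 -> ev1 D u = 0) -> u = 0.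
Proof. by move=> u0; apply/malgP => k; rewrite mcoeff0; apply: (hev_exp_eq0 u0). Qed.

(** Nonzero [y] determine a polynomial; in the Virasoro case this permits division by [y]. *)
Lemma ev2_inj (P Q : vpoly (cdfree V)) :
  (forall D y : K, y != 0 -> ev2 D y P = ev2 D y Q) -> P = Q.
Proof.
move=> E; apply/eqP; rewrite -subr_eq0; apply/eqP/malgP => k; rewrite mcoeff0.
apply: ev1_inj => D _; apply: (hev_exp_eq0 _ (lin0 (ev1_is_linear D))) => y y0.
rewrite -[LHS]/(ev2 D y (P - Q)) (linB (ev2_is_linear D y)) E ?subrr //.
Qed.

End EvaluationInjective.

Section EvaluationPoint.
Variables (K : comNzRingType) (v : 'I_3 -> K).

Definition monom_val (m : 'X_{1..3}) : K := v 0 ^+ m 0 * v 1 ^+ m 1 * v 2 ^+ m 2.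

Lemma monom_val_mmorphism : mmorphism monom_val.
Proof.
split=> [m n|]; rewrite /monom_val; last by rewrite !cm1 !expr0 !mulr1.
rewrite !cmM !exprD; move: (_ ^+ _) (_ ^+ _) (_ ^+ _) (_ ^+ _) (_ ^+ _) (_ ^+ _).
by move=> a b c d e f; ring.
Qed.

HB.instance Definition _ := isMultiplicative.Build _ _ monom_val monom_val_mmorphism.

End EvaluationPoint.

Lemma ord3P (i : 'I_3) : [\/ i = 0, i = 1 | i = 2].
Proof.
case: i => [[|[|[|//]]] lt]; [apply: Or31|apply: Or32|apply: Or33]; exact: val_inj.
Qed.

Lemma evA_var (K : fieldType) (v : 'I_3 -> K) i : evA (monom_val v) (var K i) = v i.
Proof.
rewrite /evA /var mmapU mul1r /= /monom_val !cmU.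
by case: (ord3P i) => -> /=; rewrite ?expr0 ?mul1r ?mulr1.
Qed.

(** The variables [x], [mu], [la] are removed in turn by [sum_exp_eq0], each fixing one exponent,
    until only the term of [m] is left. *)
Lemma ev3_eq0 (K : numFieldType) (V : lmodType K) (u : tens 'X_{1..3} (cdfree V)) :
  (forall v D, ev3 (monom_val v) D u = 0) -> u = 0.
Proof.
move=> u0; apply/malgP => m; rewrite mcoeff0.
have [min|/mcoeff_outdom -> //] := boolP (m \in msupp u).
apply: ev1_inj => D _.
pose vv (l n x : K) (i : 'I_3) := if i == 0 then l else if i == 1 then n else x.
pose S (P : pred 'X_{1..3}) (f : 'X_{1..3} -> K) :=
  \sum_(t <- msupp u | P t) f t *: ev1 D u@_t.
have S0 l n x : S predT (fun t => x ^+ t 2 * (n ^+ t 1 * l ^+ t 0)) = 0.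
  rewrite -[RHS](u0 (vv l n x) D) /ev3 /hev liftE; apply: eq_bigr => t _.
  by congr (_ *: _); rewrite /monom_val /vv /= [RHS]mulrC; congr (_ * _); rewrite mulrC.
have S1 l n : S (fun t => t 2 == m 2) (fun t => n ^+ t 1 * l ^+ t 0) = 0.
  apply: (sum_exp_eq0 (P := predT)) => x _; rewrite -[RHS](S0 l n x).
  by apply: eq_bigr => t _; rewrite scalerA.
have S2 l : S (fun t => (t 2 == m 2) && (t 1 == m 1)) (fun t => l ^+ t 0) = 0.
  apply: sum_exp_eq0 => n _; rewrite -[RHS](S1 l n).
  by apply: eq_bigr => t _; rewrite scalerA.
have := sum_exp_eq0 (fun l _ => S2 l) (m 0).
rewrite (eq_bigl (pred1 m)) => [|t]; last first.
  rewrite -andbA; apply/and3P/eqP => [[/eqP t2 /eqP t1 /eqP t0]|-> //].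
  by apply/eqP/cmP => i; case: (ord3P i) => ->.
by rewrite -big_filter filter_pred1_uniq ?fset_uniq // big_seq1.
Qed.

Lemma ev3_inj (K : numFieldType) (V : lmodType K) (u w : tens 'X_{1..3} (cdfree V)) :
  (forall v D, ev3 (monom_val v) D u = ev3 (monom_val v) D w) -> u = w.
Proof.
move=> E; apply/eqP; rewrite -subr_eq0; apply/eqP/ev3_eq0 => v D.
by rewrite (linB (ev3_is_linear _ D)) E subrr.
Qed.

(** * The triple rule as an identity between values *)

Section TripleRule.
Variables (K : numFieldType) (V : lmodType K).

(** [beta D y a b] stands for the value of [[a_y b]] at [d = D]; the other first arguments are the
    points to which the surrounding brackets and maps shift [d]. *)
Definition triple_values (beta : K -> K -> V -> V -> V) (T S : K -> K -> V -> V) :=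
  forall D l m x a b c,
  T D x (beta (D + x) (l + m) (beta (- (l + m)) l a b) c) =
    beta D (l + m + x) (beta (- (l + m + x)) (l + x) (T (- (l + x)) x a) b) c
    + beta D (l + m + x) (beta (- (l + m + x)) l a (S (- (m + x)) x b)) c
    + beta D (l + m) (beta (- (l + m)) l a b) (S (D + (l + m)) x c).

Variable br : cdfree V -> cdfree V -> vpoly (cdfree V).
Hypothesis brl : forall b, linear (br^~ b).
Hypothesis brr : forall a, linear (br a).
Hypothesis brdl : forall a b, br (del a) b = - mulX (br a b).
Hypothesis brdr : forall a b, br a (del b) = tmap del (br a b) + mulX (br a b).
Variables phi tau : cdfree V -> vpoly (cdfree V).
Hypothesis phil : linear phi.
Hypothesis phid : forall a, phi (del a) = tmap del (phi a) + mulX (phi a).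
Hypothesis taul : linear tau.
Hypothesis taud : forall a, tau (del a) = tmap del (tau a) + mulX (tau a).

Let T3 := tens 'X_{1..3} (cdfree V).
Let lb (s : {malg K['X_{1..3}]}) (u v : T3) : T3 := lbext br s u v.
Let app (f : cdfree V -> vpoly (cdfree V)) (s : {malg K['X_{1..3}]}) (u : T3) : T3 :=
  aext (fun a => subst s (f a)) u.

(** By [ev3_inj] the rule may be checked on values. There [a], [b] and [c] enter only through their
    own values, so generators suffice. *)
Lemma triple_ruleP :
  (let la := var K 0 in let mu := var K 1 in let x := var K 2 in
   forall a b c : cdfree V, let a : T3 := mon a mone in let b : T3 := mon b mone in
     let c : T3 := mon c mone in
   app phi x (lb (la + mu) (lb la a b) c) =
     lb (la + mu + x) (lb (la + x) (app phi x a) b) c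
     + lb (la + mu + x) (lb la a (app tau x b)) c
     + lb (la + mu) (lb la a b) (app tau x c)) <->
  triple_values (lval br) (mval phi) (mval tau).
Proof.
pose e v D (u : T3) : V := ev3 (monom_val v) D u.
pose ea v (p : {malg K['X_{1..3}]}) : K := evA (monom_val v) p.
have e_inj u w : (forall v D, e v D u = e v D w) -> u = w by apply: ev3_inj.
have e1 v D a : e v D (mon a mone) = ev1 D a by exact: ev3_one.
have eD v D u w : e v D (u + w) = e v D u + e v D w by exact: (linD (ev3_is_linear _ _)).
have eaD v p q : ea v (p + q) = ea v p + ea v q by exact: mmapD.
have ea_var v i : ea v (var K i) = v i by exact: evA_var.
have lbE v D s a b : e v D (lb s a b) =
    lval br D (ea v s) (e v (- ea v s) a) (e v (D + ea v s) b) by exact: ev3_lbext.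
have phiE v D s a : e v D (app phi s a) = mval phi D (ea v s) (e v (D + ea v s) a).
  exact: ev3_map.
have tauE v D s a : e v D (app tau s a) = mval tau D (ea v s) (e v (D + ea v s) a).
  exact: ev3_map.
(* Hence in every term [a], [b] and [c] are taken at [- l], [- m] and [D + (l + m + x)]. *)
have arith (D l m x : K) : [/\ - (l + m) + l = - m, - (l + x) + x = - l,
    - (l + m + x) + (l + x) = - m, - (l + m + x) + l = - (m + x)
    & [/\ - (m + x) + x = - m, D + (l + m) + x = D + (l + m + x)
       & D + x + (l + m) = D + (l + m + x)]].
  by do ?split; ring.
move: (var K 0) (var K 1) (var K 2) (ea_var^~ 0) (ea_var^~ 1) (ea_var^~ 2).
move=> {ea_var} la mu xi ela emu exi; clearbody lb app e ea.
split=> /= [E D l m x a b c|E a b c].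
  pose v (i : 'I_3) := if i == 0 then l else if i == 1 then m else x.
  have := congr1 (e v D) (E (mon a 0%N) (mon b 0%N) (mon c 0%N)).
  rewrite !eD !(lbE, phiE, tauE) !eaD !ela !emu !exi /=.
  have [-> -> -> -> [-> -> ->]] := arith D l m x.
  by rewrite !e1 !ev1_gen.
apply: e_inj => v D; rewrite !eD !(lbE, phiE, tauE) !eaD !ela !emu !exi.
have [-> -> -> -> [-> -> ->]] := arith D (v 0) (v 1) (v 2).
by rewrite !e1; apply: E.
Qed.

End TripleRule.

Section Instances.
Variable K : numFieldType.

Lemma vir_lval D y (a b : K^o) : lval (@lbr K (Vir K)) D y a b = a * b * (D + 2 * y).
Proof.
have -> : lval (@lbr K (Vir K)) D y a b = ev2 D y (vir_gen a b).
  by congr ev2; apply: (sesq_gen (@vir_gen_linearl K) (@vir_gen_linearr K)).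
have l2 := @ev2_is_linear K K^o D y.
rewrite /vir_gen (linZ _ l2) (linD l2) !ev2U ev1_del (linZ _ (ev1_is_linear D)).
rewrite ev1_gen expr0 scale1r expr1.
by rewrite -[LHS]/(a * b * (D * 1 + y * (2 * 1))) !mulr1 (mulrC y).
Qed.

Lemma vir_triple_ruleP (phi tau : gc (Vir K)) : triple_rule phi tau <->
  triple_values (fun D y (a b : K^o) => a * b * (D + 2 * y) : K^o) (mval phi) (mval tau).
Proof.
have := triple_ruleP (@lbr_linearl K (Vir K)) (@lbr_linearr K (Vir K))
  (@lbr_dell K (Vir K)) (@lbr_delr K (Vir K))
  (@gc_linear _ _ phi) (@gc_del _ _ phi) (@gc_linear _ _ tau) (@gc_del _ _ tau).
have E : triple_values (lval (@lbr K (Vir K))) (mval phi) (mval tau) <->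
    triple_values (fun D y (a b : K^o) => a * b * (D + 2 * y) : K^o) (mval phi) (mval tau).
  by split=> E D l m x a b c; have := E D l m x a b c; rewrite !vir_lval.
by move=> H; apply: iff_trans H E.
Qed.

Lemma cur_lval (G : lieAlgType K) D y (a b : G) : lval (@lbr K (Cur G)) D y a b = lieb a b.
Proof.
have -> : lval (@lbr K (Cur G)) D y a b = ev2 D y (mon (cur (lieb a b)) 0%N).
  by congr ev2; apply: cur_lbr.
by rewrite ev2U ev1_gen scale1r.
Qed.

Lemma cur_triple_ruleP (G : lieAlgType K) (phi tau : gc (Cur G)) : triple_rule phi tau <->
  triple_values (fun D y a b => lieb a b) (mval phi) (mval tau).
Proof.
have := triple_ruleP (@lbr_linearl K (Cur G)) (@lbr_linearr K (Cur G))
  (@lbr_dell K (Cur G)) (@lbr_delr K (Cur G))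
  (@gc_linear _ _ phi) (@gc_del _ _ phi) (@gc_linear _ _ tau) (@gc_del _ _ tau).
have E : triple_values (lval (@lbr K (Cur G))) (mval phi) (mval tau) <->
    triple_values (fun D y a b => lieb a b) (mval phi) (mval tau).
  by split=> E D l m x a b c; have := E D l m x a b c; rewrite !cur_lval.
by move=> H; apply: iff_trans H E.
Qed.

End Instances.

Section ConformalMapValues.
Variables (K : numFieldType) (V : lmodType K).
Implicit Types phi tau : cdfree V -> vpoly (cdfree V).

Lemma conformal_map_ext phi tau : linear phi -> linear tau ->
  (forall a, phi (del a) = tmap del (phi a) + mulX (phi a)) ->
  (forall a, tau (del a) = tmap del (tau a) + mulX (tau a)) ->
  (forall D y a, y != 0 -> mval phi D y a = mval tau D y a) -> phi =1 tau.
Proof.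
move=> phil taul phid taud E u; apply: ev2_inj => D y y0.
by rewrite (ev2_map phil phid) (ev2_map taul taud) E.
Qed.

End ConformalMapValues.

Section PolynomialValues.
Variable K : numFieldType.

(** The formula for the value on monomials is lifted to [{poly K}]. This is the source of polynomial
    dependence on a parameter. *)
Lemma ev2_poly (V : lmodType K) (l : V -> K^o) (P : vpoly (cdfree V)) (d y : {poly K}) :
  linear l -> exists f : {poly K}, forall x, l (ev2 d.[x] y.[x] P) = f.[x].
Proof.
move=> ll; pose g1 (i : nat) (a : V) : {poly K} := (l a : K) *: d ^+ i.
pose g2 (j : nat) (u : cdfree V) : {poly K} := y ^+ j * Defs.lift g1 u.
have l1 i : linear (g1 i) by move=> c a b; rewrite /g1 ll scalerDl scalerA.
have l1' := lift_is_linear l1.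
have l2 j : linear (g2 j) by move=> c u v; rewrite /g2 l1' mulrDr scalerAr.
exists (Defs.lift g2 P) => x.
have hl : linear (fun p : {poly K} => p.[x] : K^o).
  by move=> c p q; rewrite hornerD hornerZ.
apply: (@tens_ext K nat (cdfree V) K^o (fun P => l (ev2 d.[x] y.[x] P))
  (fun P => (Defs.lift g2 P).[x])).
- exact: (lin_comp ll (ev2_is_linear _ _)).
- exact: (lin_comp hl (lift_is_linear l2)).
move=> u j; rewrite ev2U liftU ?(lin0 (l2 j)) // /g2 hornerM horner_exp (linZ _ ll).
congr (_ * _).
apply: (@tens_ext K nat V K^o (fun u => l (ev1 d.[x] u)) (fun u => (Defs.lift g1 u).[x])).
- exact: (lin_comp ll (ev1_is_linear _)).
- exact: (lin_comp hl l1').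
move=> a i; rewrite ev1U liftU ?(lin0 (l1 i)) // /g1 hornerZ horner_exp (linZ _ ll).
exact: mulrC.
Qed.

(** Comparing coefficients, [n ^ k - n] annihilates the one of degree [k], and it vanishes for
    [k = 1] only. *)
Lemma poly_homogeneous1 (n : nat) (q : {poly K}) : (1 < n)%N ->
  (forall y, q.[n%:R * y] = n%:R * q.[y]) -> forall y, q.[y] = q.[1] * y.
Proof.
move=> n1 qn; have q0 k : k != 1%N -> q`_k = 0.
  move=> k1; have [lt|le] := ltnP k (size q); last by rewrite nth_default.
  have : (n%:R ^+ k - n%:R : K) * q`_k = 0.
    apply: (poly_fun_eq0 (W := K^o) (w := fun k => (n%:R ^+ k - n%:R) * q`_k)) lt => y _.
    rewrite -[RHS](subrr (n%:R * q.[y])) -[X in X - _]qn !horner_coef mulr_sumr -sumrB.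
    apply: eq_bigr => i _; rewrite exprMn -[LHS]/(y ^+ i * ((n%:R ^+ i - n%:R) * q`_i)).
    by ring.
  move=> /eqP; rewrite mulf_eq0 subr_eq0 => /orP[|/eqP //].
  rewrite -[X in _ == X]expr1; have [k0|] := posnP k.
    by rewrite k0 expr0 expr1 eq_sym pnatr_eq1 gtn_eqF.
  rewrite leq_eqVlt eq_sym (negPf k1) /= => lt1.
  by rewrite gt_eqF // ltr_eXn2l // ltr1n.
have -> : q = q`_1 *: 'X.
  apply/polyP => k; rewrite coefZ coefX; have [->|/q0 ->] := eqVneq k 1%N.
    by rewrite mulr1.
  by rewrite mulr0.
by move=> y; rewrite !hornerE.
Qed.

Lemma ev1_ptens (V : lmodType K) D f (a : V) : ev1 D (ptens f a : cdfree V) = f.[D] *: a.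
Proof.
rewrite /ptens (big_morph (ev1 D) (linD (ev1_is_linear D)) (lin0 (ev1_is_linear D))).
rewrite horner_coef scaler_suml; apply: eq_bigr => i _.
by rewrite ev1U scalerA mulrC.
Qed.

End PolynomialValues.

(** * The Virasoro case *)

Section VirasoroMaps.
Variable K : numFieldType.
Implicit Types phi tau : gc (Vir K).

Definition vval phi (D y : K) : K := mval phi D y (1 : K^o).

Lemma mval_vir phi D y (a : K^o) : mval phi D y a = a * vval phi D y.
Proof.
have -> : a = a *: (1 : K^o) by rewrite -[RHS]/(a * 1) mulr1.
by rewrite (linZ _ (mval_linear (gc_linear phi) D y)) -[_ *: 1]/(a * 1) mulr1.
Qed.

Lemma vir_vvalP phi tau : triple_rule phi tau <-> forall D l m x,
  (l - m) * (D + x + 2 * (l + m)) * vval phi D x =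
    vval phi (- (l + x)) x * (l - m + x) * (D + 2 * (l + m + x))
    + vval tau (- (m + x)) x * (l - m - x) * (D + 2 * (l + m + x))
    + (l - m) * (D + 2 * (l + m)) * vval tau (D + (l + m)) x.
Proof.
split=> [/vir_triple_ruleP E D l m x|E]; last apply/vir_triple_ruleP => D l m x a b c.
  have := E D l m x 1 1 1; rewrite !mval_vir => {}E.
  apply: etrans (etrans _ E) _.
    by rewrite !mul1r; ring.
  by rewrite !mul1r; ring.
rewrite !mval_vir; have := congr1 (fun z => a * b * c * z) (E D l m x) => {}E.
apply: etrans (etrans _ E) _; first by ring.
by ring.
Qed.

Lemma vval_ext phi tau : (forall D y, y != 0 -> vval phi D y = vval tau D y) -> phi =1 tau.
Proof.
move=> E; apply: (conformal_map_ext (gc_linear phi) (gc_linear tau) (@gc_del _ _ phi)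
  (@gc_del _ _ tau)).
by move=> D y a y0; rewrite !mval_vir E.
Qed.

Lemma vval_ad (r : Vir K) D y : vval (ad r) D y = ev1 (- y) r * (D + 2 * y).
Proof.
rewrite /vval /mval -[gc_fun _ _]/(lbr r _).
rewrite (ev2_br (@lbr_linearl K (Vir K)) (@lbr_linearr K (Vir K))
  (@lbr_dell K (Vir K)) (@lbr_delr K (Vir K))) vir_lval ev1_gen.
by rewrite mulr1.
Qed.

Lemma vval_poly phi (d y : {poly K}) :
  exists f : {poly K}, forall x, vval phi d.[x] y.[x] = f.[x].
Proof. exact: (ev2_poly _ _ _ (@lin_id K K^o)). Qed.

Lemma vir_GCTDer_unique phi tau : triple_rule phi tau -> triple_rule tau tau -> phi =1 tau.
Proof.
move=> /vir_vvalP Ep /vir_vvalP Et; apply: vval_ext => D x x0.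
(* With [m = l + x] the first term on the right vanishes in both rules, and this [l] makes
   [D + x + 2 * (l + m)] equal to [x]; the left-hand sides have the same nonzero coefficient
   [- (x * x)]. *)
pose l := - (D + 2 * x) / 4.
have := Ep D l (l + x) x; have := Et D l (l + x) x.
have f4 : 4 != 0 :> K by rewrite pnatr_eq0.
have -> : l - (l + x) + x = 0 by ring.
have -> : D + x + 2 * (l + (l + x)) = x by rewrite /l; field.
rewrite !mulr0 !mul0r !add0r => <- /(mulfI _) -> //.
by rewrite mulf_neq0 // opprD addrA subrr add0r oppr_eq0.
Qed.

(* With l = -y, m = x - y and D = 4y - 2x only the left-hand side and the middle
   term survive. *)
Lemma vir_CTDer_vval tau : triple_rule tau tau ->
  forall D x, x != 0 -> vval tau D x = vval tau (1 - 2 * x) x * (D + 2 * x).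
Proof.
move=> /vir_vvalP E D x x0.
have [q qE] := vval_poly tau ('X - (2 * x)%:P) x%:P.
have {}qE y : vval tau (y - 2 * x) x = q.[y] by rewrite -qE !hornerE.
have q4 y : q.[4 * y] = 4 * q.[y].
  have := E (4 * y - 2 * x) (- y) (x - y) x.
  have -> : - y - (x - y) + x = 0 by ring.
  have -> : 4 * y - 2 * x + 2 * (- y + (x - y)) = 0 by ring.
  have -> : - (x - y + x) = y - 2 * x by ring.
  rewrite !qE !mulr0 !mul0r addr0 add0r => E'.
  (* The coefficient is [- (x * x)] on the left and four times this in the middle term. *)
  have x2 : - (x * x) != 0 by rewrite oppr_eq0 mulf_neq0.
  apply: (mulfI x2); apply: etrans (etrans _ E') _; first by ring.
  by ring.
have := poly_homogeneous1 (isT : (1 < 4)%N) q4 (D + 2 * x); rewrite -!qE => <-.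
by rewrite addrK.
Qed.

Lemma vir_CTDer_inner tau : triple_rule tau tau -> CInn tau.
Proof.
move=> E; have [f fE] := vval_poly tau (1 - 2 *: 'X) 'X.
(* [f] is the factor of [D + 2 * x] in [vir_CTDer_vval]; since [ad r] evaluates [r] at [- x], it is
   composed with [- 'X]. *)
exists (ptens (f \Po - 'X) (1 : K^o)); apply: vval_ext => D x x0.
rewrite (vir_CTDer_vval E) // vval_ad ev1_ptens horner_comp !hornerE opprK -fE !hornerE.
by rewrite -[_ *: 1]/(_ * 1) mulr1.
Qed.

Lemma vir_inner_CTDer tau : CInn tau -> triple_rule tau tau.
Proof.
move=> [r rE]; apply/vir_vvalP => D l m x.
have vE D' y : vval tau D' y = ev1 (- y) r * (D' + 2 * y).
  by rewrite -vval_ad /vval /mval rE.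
by rewrite !vE; ring.
Qed.

Lemma vir_classification phi :
  (GCTDer phi <-> CTDer phi) /\ (CTDer phi <-> CInn phi).
Proof.
split; split.
- move=> [tau [taut phit]]; have E := vir_GCTDer_unique phit taut.
  have vE D y : vval phi D y = vval tau D y by rewrite /vval /mval E.
  move: taut => /vir_vvalP taut; apply/vir_vvalP => D l m x.
  by rewrite !vE; apply: taut.
- by move=> phit; exists phi.
- exact: vir_CTDer_inner.
- exact: vir_inner_CTDer.
Qed.

End VirasoroMaps.

(** * The current case *)

Section CurrentAlgebra.
Variables (K : numFieldType) (G : lieAlgType K).

Lemma mval_ad_cur (r : Cur G) D y (a : G) : mval (ad r) D y a = lieb (ev1 (- y) r) a.
Proof.
rewrite /mval -[gc_fun _ _]/(lbr r _).
by rewrite (ev2_br (@lbr_linearl K (Cur G)) (@lbr_linearr K (Cur G))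
  (@lbr_dell K (Cur G)) (@lbr_delr K (Cur G))) cur_lval ev1_gen.
Qed.

Section Generated.
Variable h : G -> vpoly (Cur G).
Hypothesis hl : linear h.

Let dX (w : vpoly (Cur G)) := tmap del w + mulX w.
Let dX_linear : linear dX.
Proof. exact/lin_add/mulX_is_linear/tmap_is_linear/del_is_linear. Qed.
Let iter_linear i : linear (fun a : G => iter i dX (h a)).
Proof. by elim: i => [|i IH] //; exact: (lin_comp dX_linear IH). Qed.

(** The only extension of [h] compatible with [d]; it supplies the triple derivation needed in the
    converse for current algebras. *)
Definition gen_map (u : Cur G) : vpoly (Cur G) := Defs.lift (fun i a => iter i dX (h a)) u.

Lemma gen_map_is_linear : linear gen_map.
Proof. exact: lift_is_linear. Qed.

Lemma gen_mapU (a : G) i : gen_map (mon a i) = iter i dX (h a).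
Proof. by rewrite /gen_map liftU // (lin0 (iter_linear i)). Qed.

Lemma gen_map_del (u : Cur G) : gen_map (del u) = tmap del (gen_map u) + mulX (gen_map u).
Proof.
apply: (@tens_ext K nat G (vpoly (Cur G)) (fun u : Cur G => gen_map (del u))
  (fun u => dX (gen_map u))).
- exact: (lin_comp gen_map_is_linear (@del_is_linear K (Cur G))).
- exact: (lin_comp dX_linear gen_map_is_linear).
by move=> a i; rewrite -[del _]/(mulX _) mulXU !gen_mapU.
Qed.

Definition gen_gc : gc (Cur G) := GC gen_map_is_linear gen_map_del.

Lemma mval_gen_gc D y (a : G) : mval gen_gc D y a = ev2 D y (h a).
Proof. by rewrite /mval /= gen_mapU. Qed.

End Generated.

(** By Jacobi [ad (e x)] is a triple derivation, and the scalar parts all multiply [[[a, b], c]], so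
    a numerical identity remains. *)
Lemma cur_triple_rule_scalar_ad (phi tau : gc (Cur G)) (alpha beta : K -> K -> K)
    (e : K -> G) :
  (forall D x a, mval phi D x a = alpha D x *: a + lieb (e x) a) ->
  (forall D x a, mval tau D x a = beta D x *: a + lieb (e x) a) ->
  (forall D l m x, alpha D x =
     alpha (- (l + x)) x + beta (- (m + x)) x + beta (D + (l + m)) x) ->
  triple_rule phi tau.
Proof.
move=> pE tE ab; apply/cur_triple_ruleP => D l m x a b c.
rewrite !pE !tE (ab D l m) lieb_derivation (lieb_derivation (e x) a).
rewrite !(linD (lieb_linearl _)) !(linD (lieb_linearr _)) !(linD (lieb_linearl _)).
rewrite !(linZ _ (lieb_linearl _)) !(linZ _ (lieb_linearr _)) !(linZ _ (lieb_linearl _)).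
by apply: esym; rewrite [X in X + _ = _]addrACA [LHS]addrACA -!scalerDl.
Qed.

End CurrentAlgebra.

(** * Triple rules on a simple Lie algebra for a fixed value of the indeterminate *)

Section SimpleTripleMaps.
Variables (C : numClosedFieldType) (G : finLieAlgType C).
Hypothesis simpleG : lie_simple G.

Lemma lie_simple_ext2 (f g : G -> G) : linear f -> linear g ->
  (forall a b c, f (lieb (lieb a b) c) = g (lieb (lieb a b) c)) -> f =1 g.
Proof.
move=> lf lg E x; apply/eqP; rewrite -subr_eq0; apply/eqP.
move: x; apply: (lie_simple_ext simpleG) => [|x y]; first exact/lin_add/lin_opp/lg/lf.
move: x; apply: (lie_simple_ext simpleG) => [|a b]; last by rewrite E subrr.
exact: (lin_comp (lin_add lf (lin_opp lg)) (lieb_linearl y)).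
Qed.

Lemma lie_simple_center2 (c : G) : (forall a b, lieb (lieb a b) c = 0) -> c = 0.
Proof.
move=> c0; apply: (lie_simple_center simpleG).
exact: (lie_simple_ext simpleG (lieb_linearl c)).
Qed.

(* By Jacobi f [a, u] = [f a, u] if u is a bracket. *)
Lemma centroid_of_triple (f : G -> G) : linear f ->
  (forall a b c, f (lieb (lieb a b) c) = lieb (lieb (f a) b) c) ->
  exists k, forall a, f a = k *: a.
Proof.
move=> lf E; apply: (lie_simple_schur simpleG lf) => a b.
suff Er x y : f (lieb x y) = lieb (f x) y.
  by rewrite lieb_anti (linN lf) Er -lieb_anti.
apply/eqP; rewrite -subr_eq0; apply/eqP; move: y; apply: (lie_simple_ext simpleG).
  apply: lin_add; first exact: (lin_comp lf (lieb_linearr x)).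
  exact/lin_opp/lieb_linearr.
move=> y z; have J u : lieb u (lieb y z) = lieb (lieb u y) z - lieb (lieb u z) y.
  by rewrite lieb_derivation (lieb_anti y (lieb u z)).
by rewrite J (linB lf) !E -J subrr.
Qed.

Lemma functional_ext (v : G) : (forall l : G -> C^o, linear l -> l v = 0) -> v = 0.
Proof.
move=> l0; rewrite [v](coord_vbasis (memvf v)) big1 // => i _.
by rewrite (l0 (coord (vbasis fullv) i)) ?scale0r // => c y z; rewrite linearP.
Qed.

(* For a fixed x, [T] and [S] are the values of phi_x and tau_x on generators as
   functions of d; p and q are the arguments - (l + x) and - (m + x). *)
Section Pointwise.
Variables (x : C) (T S : C -> G -> G).
Hypothesis Tl : forall D, linear (T D).
Hypothesis Sl : forall D, linear (S D).
Hypothesis SSrule : forall D p q a b c, S D (lieb (lieb a b) c) =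
  lieb (lieb (S p a) b) c + lieb (lieb a (S q b)) c
  + lieb (lieb a b) (S (D - 2 * x - p - q) c).
Hypothesis Spoly : forall (l : G -> C^o) a, linear l ->
  exists f : {poly C}, forall D, l (S D a) = f.[D].

(** Replacing [p = 0] by [p = - h] moves the argument at [c] by [h] and leaves the left-hand side
    alone, so [[[a, b], S (r + h) c - S r c]] does not depend on [r]. *)
Lemma triple_values_additive r h c : S (r + h) c - S r c = S h c - S 0 c.
Proof.
apply/eqP; rewrite -subr_eq0; apply/eqP/lie_simple_center2 => a b.
have cancel (A0 A1 B X0 X1 : G) : A1 + B + X1 = A0 + B + X0 -> X1 - X0 = A0 - A1.
  move=> E; apply/eqP; rewrite subr_eq; apply/eqP/(addrI (A1 + B)).
  by rewrite E addrA; congr (_ + _); rewrite (addrC A1) -addrA (addrC A1) subrK addrC.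
have E r' : lieb (lieb a b) (S (r' + h) c - S r' c) =
    lieb (lieb (S 0 a) b) c - lieb (lieb (S (- h) a) b) c.
  rewrite (linB (lieb_linearr _)); apply: (cancel _ _ (lieb (lieb a (S 0 b)) c)).
  have := SSrule (r' + 2 * x) 0 0 a b c; rewrite (SSrule (r' + 2 * x) (- h) 0).
  have -> : r' + 2 * x - 2 * x - - h - 0 = r' + h by ring.
  by have -> : r' + 2 * x - 2 * x - 0 - 0 = r' by ring.
by rewrite (linB (lieb_linearr _)) E; have := E 0; rewrite add0r => ->; rewrite subrr.
Qed.

(** Under a functional, [S D c - S 0 c] becomes a polynomial in [D]; additivity gives
    [q(2y) = 2 q(y)], which forces it to be linear. *)
Lemma triple_values_affine D c : S D c = S 0 c + D *: (S 1 c - S 0 c).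
Proof.
apply/eqP; rewrite addrC -subr_eq -subr_eq0; apply/eqP/functional_ext => l ll.
have [p pE] := Spoly c ll; pose q := p - p.[0]%:P.
have qE y : q.[y] = l (S y c - S 0 c) by rewrite (linB ll) !pE /q !hornerE.
have q2 y : q.[2 * y] = 2 * q.[y].
  have E := triple_values_additive y y c; rewrite -mulr2n -mulr_natl in E.
  rewrite !qE -[S (2 * y) c](subrK (S y c)) E -addrA (linD ll).
  by rewrite mulr_natl mulr2n.
rewrite (linB ll) (linZ _ ll) -!qE (poly_homogeneous1 (isT : (1 < 2)%N) q2 D).
by rewrite -[_ *: _]/(_ * _) mulrC subrr.
Qed.

Lemma triple_values_CT : exists s e, forall D a, S D a = (s * (D + x)) *: a + lieb e a.
Proof.
pose S1 a := S 1 a - S 0 a.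
have S1l : linear S1 by apply: lin_add => //; apply: lin_opp.
have aff D c : S D c = S 0 c + D *: S1 c := triple_values_affine D c.
(* Subtracting the rules at [D = 1] and [D = 0] with [p = q = 0] removes the first two terms. *)
have S1D a b c : S1 (lieb (lieb a b) c) = lieb (lieb a b) (S1 c).
  rewrite /S1 (SSrule 1 0 0) (SSrule 0 0 0) (linB (lieb_linearr _)).
  rewrite opprD addrACA subrr add0r -!(linB (lieb_linearr _)); congr lieb.
  rewrite !(aff (_ - 0)) !subr0 opprD addrACA subrr add0r -scalerBl.
  have -> : 1 - 2 * x - (0 - 2 * x) = 1 by ring.
  by rewrite scale1r.
have [s sE] : exists s, forall a, S1 a = s *: a.
  apply: (lie_simple_schur simpleG S1l) => a b; apply/eqP; rewrite -subr_eq0; apply/eqP.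
  move: a; apply: (lie_simple_ext simpleG) => [|y z]; last by rewrite S1D subrr.
  apply: lin_add; first exact: (lin_comp S1l (lieb_linearl b)).
  exact/lin_opp/lieb_linearl.
(* In the rule at [D = 0] the last argument [- 2 * x] contributes [- 2 * s * x]. Subtracting [s * x]
   from [S 0] balances this: it enters once on the left and three times on the right. *)
pose d a := S 0 a - (s * x) *: a.
have dl : linear d by apply: lin_add => //; apply/lin_opp/lin_scale/lin_id.
pose dL := linfun (linear_pack dl); have dE a : dL a = d a by rewrite lfunE.
have [e eE] : exists e, forall a, dL a = lieb e a.
  apply: (triple_derivation_inner simpleG) => a b c; rewrite !dE /d (SSrule 0 0 0) !subr0 sub0r.
  rewrite (aff (- _)) sE !(linB (lieb_linearl _)) !(linB (lieb_linearr _)).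
  rewrite !(linB (lieb_linearl _)) (linD (lieb_linearr _)).
  rewrite !(linZ _ (lieb_linearl _)) !(linZ _ (lieb_linearr _)) !(linZ _ (lieb_linearl _)).
  have E2 : - (2 * x) * s = - (s * x) - s * x by ring.
  rewrite scalerA E2 scalerDl scaleNr; move: (_ *: _) (lieb _ (S 0 c)) => w u.
  move: (lieb (lieb a (S 0 b)) c) => v; rewrite [X in _ = X + _]addrACA [RHS]addrA.
  by congr (_ - _); rewrite (addrC u) [LHS]addrA.
exists s, e => D a; rewrite -eE dE /d aff sE scalerA mulrDr scalerDl.
rewrite (mulrC D) addrC -addrA; congr (_ + _).
by rewrite addrC subrK.
Qed.

Hypothesis TSrule : forall D p q a b c, T D (lieb (lieb a b) c) =
  lieb (lieb (T p a) b) c + lieb (lieb a (S q b)) c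
  + lieb (lieb a b) (S (D - 2 * x - p - q) c).

(** Subtracting the two rules leaves [U D [[a, b], c] = [[U p a, b], c]] for all [D] and [p], where
    [U = T - S]; so [U] is constant in [D] and lies in the centroid. *)
Lemma triple_values_GCT : exists s g e, forall D a,
  T D a = (s * D + g) *: a + lieb e a.
Proof.
have [s [e SE]] := triple_values_CT; pose U D a := T D a - S D a.
have Ul D : linear (U D) by apply: lin_add => //; apply: lin_opp.
have UE D p a b c : U D (lieb (lieb a b) c) = lieb (lieb (U p a) b) c.
  rewrite /U (TSrule D p 0) (SSrule D p 0) [in LHS]opprD addrACA subrr addr0.
  by rewrite opprD addrACA subrr addr0 !(linB (lieb_linearl _)).
have U0 D : U D =1 U 0.
  by apply: lie_simple_ext2 => // a b c; rewrite (UE D 0) (UE 0 0).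
have [k kE] := centroid_of_triple (Ul 0) (UE 0 0).
exists s, (s * x + k), e => D a.
have -> : T D a = S D a + U D a by rewrite addrC subrK.
by rewrite SE U0 kE mulrDr addrA [in RHS]scalerDl addrAC.
Qed.

End Pointwise.
End SimpleTripleMaps.

(** * Polynomial dependence on the indeterminate, and the classification *)

Section CurrentMaps.
Variables (C : numClosedFieldType) (G : finLieAlgType C).
Hypothesis simpleG : lie_simple G.

Lemma exists_functional (v : G) : v != 0 -> exists2 l : G -> C^o, linear l & l v = 1.
Proof.
move=> v0; have [i vi] : exists i, coord (vbasis (fullv : {vspace G})) i v != 0.
  apply/existsP; apply: contraNT v0 => /existsPn v0.
  rewrite [v](coord_vbasis (memvf v)) big1 // => i _.
  by have /negPn/eqP -> := v0 i; rewrite scale0r.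
exists (fun w => (coord (vbasis fullv) i v)^-1 * coord (vbasis fullv) i w).
  by move=> c a b; rewrite linearP mulrDr mulrCA.
by rewrite mulVf.
Qed.

Lemma ltraceE (f : 'End(G)) :
  ltrace f = \sum_i (v2r (f (r2v (delta_mx 0 i)))) 0 i.
Proof.
by rewrite /ltrace /mxtrace; apply: eq_bigr => i _; rewrite -mul_f2mx -rowE mxE.
Qed.

Lemma ltrace_ad (y : G) : ltrace (adE y) = 0.
Proof.
have ll : linear (fun y : G => ltrace (adE y) : C^o).
  by move=> c a b; rewrite adE_is_linear ltrace_is_linear.
apply: (lie_simple_ext simpleG ll) => a b.
by rewrite adE_lieb ltraceB ltraceC subrr.
Qed.

Definition mvalL (phi : gc (Cur G)) (D x : C) : 'End(G) :=
  linfun (linear_pack (mval_linear (gc_linear phi) D x)).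

Lemma mvalLE phi D x a : mvalL phi D x a = mval phi D x a.
Proof. by rewrite lfunE. Qed.

Lemma mval_poly phi (l : G -> C^o) a (d y : {poly C}) : linear l ->
  exists f : {poly C}, forall x, l (mval phi d.[x] y.[x] a) = f.[x].
Proof. exact: ev2_poly. Qed.

Lemma ltrace_poly phi (y : G) :
  exists f : {poly C}, forall x, ltrace (mvalL phi 0 x \o adE y)%VF = f.[x].
Proof.
have [F FE] : exists F : 'I_(dim G) -> {poly C}, forall i x,
    (v2r ((mvalL phi 0 x \o adE y)%VF (r2v (delta_mx 0 i)))) 0 i = (F i).[x].
  apply: (@fin_all_exists _ _ (fun i f => forall x, _ = f.[x])) => i.
  have li : linear (fun v : G => (v2r v) 0 i : C^o).
    by move=> c a b; rewrite linearP !mxE.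
  have [f fE] := mval_poly phi (lieb y (r2v (delta_mx 0 i))) 0 'X li.
  by exists f => x; rewrite comp_lfunE adEE mvalLE -fE hornerX hornerC.
exists (\sum_i F i) => x; rewrite ltraceE horner_sum.
by apply: eq_bigr => i _; apply: FE.
Qed.

Lemma cur_values_poly (phi : gc (Cur G)) :
  (forall x, exists s g e, forall D a, mval phi D x a = (s * D + g) *: a + lieb e a) ->
  exists (f g : {poly C}) (r : Cur G), forall D x a,
    mval phi D x a = (f.[x] * D + g.[x]) *: a + lieb (ev1 (- x) r) a.
Proof.
move=> loc; have [a0 [b0 ab0]] := simpleG.1.
have a00 : a0 != 0 by apply: contraNneq ab0 => ->; rewrite (lin0 (lieb_linearl b0)).
(* At [a0] the functional [l] takes the values [s + g + l [e, a0]] for [D = 1] and [g + l [e, a0]]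
   for [D = 0], which determine [s], and [g] once [e] is known. *)
have [l ll la0] := exists_functional a00.
have [f1 f1E] := mval_poly phi a0 1 'X ll; have [f0 f0E] := mval_poly phi a0 0 'X ll.
have [F FE] : exists F : 'I_(\dim {:G}) -> {poly C}, forall i x s g e,
    (forall D a, mval phi D x a = (s * D + g) *: a + lieb e a) ->
    coord (vbasis fullv) i e = (F i).[x].
  apply: (@fin_all_exists _ _ (fun i f => forall x s g e, _ -> _ = f.[x])) => i.
  have lc : linear (coord (vbasis (fullv : {vspace G})) i : G -> C^o).
    by move=> c a b; rewrite linearP.
  (* The coordinate of [e] is [killing y e], hence the trace of [mvalL phi 0 x] composed with
     [ad y]: the scalar part drops out as [ad y] is traceless. *)
  have [y yE] := killing_representation simpleG lc.
  have [f fE] := ltrace_poly phi y; exists f => x s g e E.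
  rewrite yE killingC -fE; have -> : mvalL phi 0 x = g *: \1%VF + adE e.
    apply/lfunP => a; rewrite mvalLE E mulr0 add0r.
    by rewrite add_lfunE scale_lfunE id_lfunE adEE.
  rewrite comp_lfunDl -comp_lfunZl comp_lfun1l ltraceD.
  by rewrite (linZ _ (@ltrace_is_linear _ _)) ltrace_ad scaler0 add0r.
pose b (i : 'I_(\dim {:G})) : G := (vbasis (fullv : {vspace G}))`_i.
pose r : Cur G := \sum_i (ptens (F i \Po - 'X) (b i) : cdfree G).
have rE x : ev1 (- x) r = \sum_i (F i).[x] *: b i.
  rewrite /r (big_morph (ev1 (- x)) (linD (ev1_is_linear _)) (lin0 (ev1_is_linear _))).
  by apply: eq_bigr => i _; rewrite ev1_ptens horner_comp !hornerE opprK.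
exists (f1 - f0), (f0 - \sum_i l (lieb (b i) a0) *: F i), r => D x a.
have [s [g [e E]]] := loc x.
have eE : e = ev1 (- x) r.
  rewrite rE [LHS](coord_vbasis (memvf e)); apply: eq_bigr => i _.
  by rewrite (FE i x s g e).
have sE : (f1 - f0).[x] = s.
  rewrite hornerD hornerN -f1E -f0E !hornerE !E !(linD ll) !(linZ _ ll) la0.
  by rewrite -![_ *: 1]/(_ * 1); ring.
suff gE : (f0 - \sum_i l (lieb (b i) a0) *: F i).[x] = g by rewrite sE gE -eE E.
have lE : l (lieb e a0) = (\sum_i l (lieb (b i) a0) *: F i).[x].
  have lbl := lin_comp ll (lieb_linearl a0).
  rewrite eE rE horner_sum (big_morph (fun v => l (lieb v a0)) (linD lbl) (lin0 lbl)).
  apply: eq_bigr => i _; rewrite (linZ _ lbl) hornerZ.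
  exact: mulrC.
rewrite hornerD hornerN -lE -f0E !hornerE E (linD ll) (linZ _ ll) la0.
by rewrite -[_ *: 1]/(_ * 1); ring.
Qed.

Lemma cur_rule_shift (phi tau : gc (Cur G)) : triple_rule phi tau ->
  forall x D p q a b c, mval phi D x (lieb (lieb a b) c) =
    lieb (lieb (mval phi p x a) b) c + lieb (lieb a (mval tau q x b)) c
    + lieb (lieb a b) (mval tau (D - 2 * x - p - q) x c).
Proof.
move=> /cur_triple_ruleP E x D p q a b c.
have := E D (- x - p) (- x - q) x a b c.
have -> : - (- x - p + x) = p by ring.
have -> : - (- x - q + x) = q by ring.
by have -> : D + (- x - p + (- x - q)) = D - 2 * x - p - q by ring.
Qed.

Lemma cur_GCTDer_values (phi : gc (Cur G)) : GCTDer phi ->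
  exists (f g : {poly C}) (r : Cur G), forall D x a,
    mval phi D x a = (f.[x] * D + g.[x]) *: a + lieb (ev1 (- x) r) a.
Proof.
move=> [tau [/cur_rule_shift tautau /cur_rule_shift phitau]].
apply: cur_values_poly => x.
apply: (triple_values_GCT simpleG (T := fun D => mval phi D x)
  (S := fun D => mval tau D x) (x := x)) => //.
- by move=> D; exact: (mval_linear (gc_linear phi) D x).
- by move=> D; exact: (mval_linear (gc_linear tau) D x).
move=> l a ll; have [f fE] := mval_poly tau a 'X x%:P ll.
by exists f => D; rewrite -fE hornerX hornerC.
Qed.

Lemma ptens_is_linear (V : lmodType C) (p : {poly C}) : linear (ptens p : V -> vpoly V).
Proof.
move=> c a b; rewrite /ptens scaler_sumr -big_split /=; apply: eq_bigr => i _.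
rewrite -(mon_is_linear (i : nat)); congr mon.
by rewrite scalerDr !scalerA mulrC.
Qed.

Lemma cur_classification (phi : gc (Cur G)) :
  GCTDer phi <->
  exists (f g : {poly C}) (d : gc (Cur G)), CInn d /\
    forall a : G,
      phi (cur a) = ptens f (del (cur a)) + ptens g (cur a) + d (cur a).
Proof.
have genE (f g : {poly C}) (d : gc (Cur G)) (a : G) D x :
    ev2 D x (ptens f (del (cur a)) + ptens g (cur a) + d (cur a)) =
    (f.[x] * D + g.[x]) *: a + mval d D x a.
  have l2 := @ev2_is_linear C G D x.
  by rewrite !(linD l2) !ev2_ptens ev1_del ev1_gen scalerA -scalerDl.
split=> [/cur_GCTDer_values[f [g [r E]]]|[f [g [d [[r dr] E]]]]].
  exists f, g, (ad r); split; first by exists r.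
  move=> a; apply: ev2_inj => D x _; rewrite genE mval_ad_cur -E.
  by rewrite /mval.
have dE D x a : mval d D x a = lieb (ev1 (- x) r) a.
  by rewrite -(mval_ad_cur r D) /mval dr.
(* The companion of [phi] gets the form required by [triple_values_CT], with [s] the value of
   [f]. *)
pose h (a : G) : vpoly (Cur G) :=
  ptens f (del (cur a)) + mulX (ptens f (cur a)) + lbr r (cur a).
have curl : linear (@cur G) by apply: mon_is_linear.
have hl : linear h.
  apply: lin_add; last exact: (lin_comp (lbr_linearr r) curl).
  apply: lin_add.
    exact: (lin_comp (ptens_is_linear f) (lin_comp (@del_is_linear _ (Cur G)) curl)).
  exact: (lin_comp (@mulX_is_linear _ _) (lin_comp (ptens_is_linear f) curl)).
have tE D x a : mval (gen_gc hl) D x a = (f.[x] * (D + x)) *: a + lieb (ev1 (- x) r) a.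
  have l2 := @ev2_is_linear C G D x.
  rewrite mval_gen_gc /h !(linD l2) ev2_mulX !ev2_ptens ev1_del ev1_gen.
  rewrite -(mval_ad_cur r D) /mval; congr (_ + _).
  by rewrite !scalerA -scalerDl mulrDr (mulrC x).
have pE D x a : mval phi D x a = (f.[x] * D + g.[x]) *: a + lieb (ev1 (- x) r) a.
  by rewrite -(dE D) -genE -E.
exists (gen_gc hl); split.
  by apply: (cur_triple_rule_scalar_ad tE tE) => D l m x; ring.
(* The term [g] occurs once on each side, through [phi]. *)
by apply: (cur_triple_rule_scalar_ad pE tE) => D l m x; ring.
Qed.

End CurrentMaps.

Theorem theorem4p8 (R : realType) :
  (forall phi : gc (Vir R[i]),
     (GCTDer phi <-> CTDer phi) /\ (CTDer phi <-> CInn phi)) /\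
  (forall G : finLieAlgType R[i], lie_simple G ->
   forall phi : gc (Cur G),
     GCTDer phi <->
     exists (f g : {poly R[i]}) (d : gc (Cur G)), CInn d /\
       forall a : G,
         phi (cur a) = ptens f (del (cur a)) + ptens g (cur a) + d (cur a)).
Proof.
split; first exact: vir_classification.
by move=> G simpleG phi; exact: cur_classification.
Qed.
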